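(* Let $(X_t,Y_t)$ be the Brownian swapping process with swap rate $s>0$ started at $(x_0,y_0)\in\mathbb{R}^2$ (described in the context). For every $t>0$, writing $\mu_\Delta(t):=\mathbb{E}[X_t]-\mathbb{E}[Y_t]$, $$\mathbb{E}[X_t]=\frac{x_0+y_0}{2}+\frac{x_0-y_0}{2}e^{-2st}+\frac{\mu_1+\mu_2}{2}t+\frac{\mu_1-\mu_2}{4s}(1-e^{-2st}),$$ $$\mu_\Delta(t)=(x_0-y_0)e^{-2st}+\frac{\mu_1-\mu_2}{2s}(1-e^{-2st}),$$ $$\mathrm{Var}(X_t)=\Bigl(\frac{\sigma_1^2+\sigma_2^2}{2}+\frac{(\mu_1-\mu_2)^2}{4s}\Bigr)t+\frac{(x_0-y_0)^2-\mu_\Delta(t)^2}{4}+\Bigl[\frac{(\mu_1-\mu_2)(x_0-y_0)}{4s}+\frac{\sigma_1^2-\sigma_2^2}{4s}-\frac{(\mu_1-\mu_2)^2}{8s^2}\Bigr](1-e^{-2st}),$$ $$\mathrm{Var}(X_t)-\mathrm{Var}(Y_t)=\frac{\sigma_1^2-\sigma_2^2}{2s}(1-e^{-2st}),$$ $$\mathrm{Cov}(X_t,Y_t)=\frac{\mu_\Delta(t)^2-(x_0-y_0)^2}{4}-\frac{(\mu_1-\mu_2)^2}{4s}t-\frac{(\mu_1-\mu_2)(x_0-y_0)}{4s}(1-e^{-2st})+\frac{(\mu_1-\mu_2)^2}{8s^2}(1-e^{-2st}).$$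
   Context: The Brownian swapping process with parameters $\mu_1,\mu_2\in\mathbb{R}$, $\sigma_1,\sigma_2>0$, $s>0$ is the càdlàg Markov process $(X,Y)$ on $\mathbb{R}^2$ with $\mathrm{d}X_t=\mu_1\mathrm{d}t+\sigma_1\mathrm{d}W^1_t+(Y_{t-}-X_{t-})\mathrm{d}\mathcal{N}_t$, $\mathrm{d}Y_t=\mu_2\mathrm{d}t+\sigma_2\mathrm{d}W^2_t+(X_{t-}-Y_{t-})\mathrm{d}\mathcal{N}_t$, $(X_0,Y_0)=(x_0,y_0)$, where $W^1,W^2$ are independent standard one-dimensional Brownian motions and $\mathcal{N}$ is an independent Poisson process of rate $s$ (at each jump of $\mathcal{N}$ the two coordinates are exchanged). Its generator is $\mathcal{L}f(x,y)=\mu_1\partial_xf+\mu_2\partial_yf+\frac{\sigma_1^2}{2}\partial_x^2f+\frac{\sigma_2^2}{2}\partial_y^2f+s[f(y,x)-f(x,y)]$. *)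

(* Defs.v *)
From HB Require Import structures.
From mathcomp Require Import all_boot all_order all_algebra.
From mathcomp Require Import all_classical all_reals all_analysis.

Set Implicit Arguments.
Unset Strict Implicit.
Unset Printing Implicit Defensive.

Import Order.TTheory GRing.Theory Num.Theory.
Import numFieldNormedType.Exports.

Local Open Scope classical_set_scope.
Local Open Scope ring_scope.

(* Time is [0, +oo): processes are families indexed by R, and their values at
   negative times are never constrained nor used. *)

Section independence.
Context (d : measure_display) (T : measurableType d) (R : realType).
Variable P : probability T R.

(* Mutual independence of a finite family of sigma-algebras.  Since every F i
   contains setT, the product rule for subfamilies is included. *)
Definition independent_sigma (I : finType) (F : I -> set (set T)) : Prop :=
  forall E : I -> set T, (forall i, F i (E i)) ->
    P (\bigcap_i E i) = (\prod_i P (E i))%E.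

Definition sigma_rv (Z : T -> R) : set (set T) :=
  preimage_set_system setT Z measurable.

Definition sigma_process (Z : R -> T -> R) : set (set T) :=
  <<s \bigcup_(t in `[0, +oo[) sigma_rv (Z t) >>.

Definition independent_processes (n : nat) (Z : 'I_n -> R -> T -> R) : Prop :=
  independent_sigma (fun i => sigma_process (Z i)).

Definition independent_increments (Z : R -> T -> R) : Prop :=
  forall (n : nat) (t : nat -> R),
    0 <= t 0%N -> {homo t : i j / (i <= j)%N >-> i <= j} ->
    independent_sigma (fun i : 'I_n => sigma_rv (Z (t i.+1) \- Z (t i))).

End independence.

Section processes.
Context (d : measure_display) (T : measurableType d) (R : realType).
Variable P : probability T R.

Definition brownian_motion (W : R -> {RV P >-> R}) : Prop :=
  [/\ {ae P, forall w, W 0 w = 0 /\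
                       {within `[0, +oo[, continuous (fun t => W t w)}},
      independent_increments P W
    & forall u t, 0 <= u < t -> forall A : set R, measurable A ->
        P ((W t \- W u) @^-1` A) = normal_prob 0 (Num.sqrt (t - u)) A].

Definition poisson_process (rate : R) (N : R -> {RV P >-> R}) : Prop :=
  [/\ {ae P, forall w, [/\ N 0 w = 0,
        forall t, 0 <= t -> N t w \is a Num.nat,
        forall u t, 0 <= u <= t -> N u w <= N t w
      & forall t, 0 <= t -> N x w @[x --> t^'+] --> N t w]},
      independent_increments P N
    & forall u t, 0 <= u < t -> forall k : nat,
        P [set w | N t w - N u w = k%:R] =
          (poisson_pmf (rate * (t - u)) k)%:E].

Definition cadlag (f : R -> R) : Prop :=
  (forall t, 0 <= t -> f x @[x --> t^'+] --> f t) /\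
  (forall t, 0 < t -> cvg (f x @[x --> t^'-])).

Definition left_lim (f : R -> R) (t : R) : R := lim (f x @[x --> t^'-]).

(* The pathwise Stieltjes integral of H_{u-} dN_u over (0, t], for a path N that
   is a pure-jump step function.  Only the finitely many jump times of N in
   (0, t] contribute; the finite-support sum would be 0 by convention if there
   were infinitely many nonzero terms, which a path of a Poisson process
   excludes. *)
Definition jump_integral (H N : R -> R) (t : R) : R :=
  \sum_(u \in `]0, t]) left_lim H u * (N u - left_lim N u).

(* The stochastic differential equation in integral form.  Its coefficients in
   front of the Brownian motions are constant, so that it makes sense pathwise. *)
Definition brownian_swapping_process (mu1 mu2 sigma1 sigma2 s x0 y0 : R)
    (X Y : R -> {RV P >-> R}) : Prop :=
  exists W1 W2 N : R -> {RV P >-> R},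
  [/\ brownian_motion W1, brownian_motion W2, poisson_process s N,
      independent_processes P
        (tnth [tuple (W1 : R -> T -> R); (W2 : R -> T -> R); (N : R -> T -> R)])
    & {ae P, forall w,
        [/\ cadlag (fun t => X t w), cadlag (fun t => Y t w)
          & forall t, 0 <= t ->
            X t w = x0 + mu1 * t + sigma1 * W1 t w
              + jump_integral (fun u => Y u w - X u w) (fun u => N u w) t /\
            Y t w = y0 + mu2 * t + sigma2 * W2 t w
              + jump_integral (fun u => X u w - Y u w) (fun u => N u w) t]}].

End processes.

(* Main.v *)
From HB Require Import structures.
Require Import Defs.
From mathcomp Require Import all_boot all_order all_algebra.
From mathcomp Require Import all_classical all_reals all_analysis.
From mathcomp Require Import measurable_realfun ring lra.

(** The sum S = X + Y and the difference D = X - Y decouple the dynamics. In S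
    the two jump integrals cancel, so that S_t is almost surely
    x0 + y0 + (mu1 + mu2) t + sigma1 W1_t + sigma2 W2_t. The difference is turned
    into its opposite by every jump of the Poisson process N and otherwise
    follows Z_u = x0 - y0 + (mu1 - mu2) u + sigma1 W1_u - sigma2 W2_u; that is,
    D = Z - 2 int D_- dN, whose solution is
    D_t = (-1)^(N_t) Z_0 + int_0^t (-1)^(N_t - N_u) dZ_u.
    Since N is independent of W1 and W2 and E (-1)^(N_t - N_u) = exp(-2 s (t - u))
    ([Ex_flip]), the moments of D_t, and its covariance with S_t, follow from the
    Ito isometry given N and elementary integrals of exponentials. As
    X = (S + D) / 2 and Y = (S - D) / 2, one has
    Var X = (Var S + Var D + 2 Cov(S, D)) / 4, Cov(X, Y) = (Var S - Var D) / 4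
    and Var X - Var Y = Cov(S, D), which gives all the formulas.

    The integral is not constructed: it is replaced by its Riemann sums on
    dyadic grids, the Euler scheme. Two kinds of convergence to D_t are combined.
    - Almost surely, by a pathwise argument ([euler_cvg]): the scheme is exact on
      cells without jump, makes an error bounded by the oscillation of Z on cells
      with one jump, and almost surely no cell of a fine enough grid contains two
      jumps ([single_jump_cells]).
    - In mean square: the isometry ([noise_isometry]), which rests on the
      independence of N from the Brownian motions and on the orthogonality of
      their increments, shows that the scheme is Cauchy with an explicit rate
      ([scheme_cauchy]); Fatou's lemma identifies its L2 limit with the almost
      sure one ([L2_limit]).
    So the moments of D_t are limits of those of the scheme, which are geometric
    sums in q = exp(-2 s h), where h is the mesh ([scheme_mean],
    [scheme_second_moment], [scheme_noise_total]); one concludes with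
    h / (1 - q) --> 1 / (2 s) ([step_ratio_cvg]). *)

Import Order.TTheory GRing.Theory Num.Theory.
Import numFieldNormedType.Exports.

Local Open Scope classical_set_scope.
Local Open Scope ring_scope.

Set Implicit Arguments.
Unset Strict Implicit.
Unset Printing Implicit Defensive.

(** * Parity of a counting path and uniform continuity *)

Section pathwise.
Context {R : realType}.
Implicit Types (N Z D H : R -> R) (u v w e : R).

(** Heine's theorem on [a, b]; the second point is allowed to lie beyond b so
    that no boundary case arises at the last cell of a subdivision. *)
Lemma heine_segment (f : R -> R) (a b e : R) :
  {within `[a, +oo[, continuous f} -> 0 < e ->
  exists2 dl : R, 0 < dl & forall u v, a <= u <= b -> a <= v ->
    `|u - v| < dl -> `|f u - f v| < e.
Proof.
move=> /subspace_continuousP cf e0.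
have /compact_near_coveringP nc := @segment_compact R a b.
pose Q (dl u : R) := forall v, a <= v -> `|u - v| < dl -> `|f u - f v| < e.
have : \forall dl \near (0 : R)^'+, `[a, b] `<=` (fun u => a <= u -> Q dl u).
  apply: (nc R (0 : R)^'+ (fun dl u => a <= u -> Q dl u)).
  move=> x; rewrite /= in_itv/= => /andP[ax xb].
  have /cf/cvgrPdist_lt/(_ _ (divr_gt0 e0 (ltr0n R 2))) : `[a, +oo[%classic x.
    by rewrite /= in_itv/= andbT.
  rewrite near_withinE => /nbhs_ballP[r /= r0 hr].
  have r20 : 0 < r / 2 by rewrite divr_gt0.
  exists (ball x (r / 2), [set dl | 0 < dl < r / 2]) => /=.
    split; first exact: nbhsx_ballx.
    by near=> dl => /=; apply/andP; split; near: dl;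
      [exact: nbhs_right_gt|exact: nbhs_right_lt].
  move=> [u dl] /= [xu /andP[dl0 dlr]] au v av uv.
  rewrite /ball /= in xu.
  have hu : `|f x - f u| < e / 2.
    by apply: hr; rewrite /ball /= ?in_itv/= ?andbT//; lra.
  have hv : `|f x - f v| < e / 2.
    apply: hr; rewrite /ball /= ?in_itv/= ?andbT//.
    have := ler_distD u x v; lra.
  by have := ler_distD (f x) (f u) (f v); rewrite (distrC (f u) (f x)); lra.
move=> hP; have [dl [dl0 hdl]] := filter_ex (filterI (nbhs_right_gt 0) hP).
exists dl => // u v /andP[au ub]; apply: hdl => //.
by rewrite /= in_itv/= au.
Unshelve. all: by end_near. Qed.

Lemma cos_pi_nat (k : nat) : cos (pi * k%:R) = (-1) ^+ k :> R.
Proof.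
elim: k => [|k IH]; first by rewrite mulr0 cos0 expr0.
by rewrite -natr1 mulrDr mulr1 cosDpi IH exprS mulN1r.
Qed.

Lemma sin_pi_nat (k : nat) : sin (pi * k%:R) = 0 :> R.
Proof.
elim: k => [|k IH]; first by rewrite mulr0 sin0.
by rewrite -natr1 mulrDr mulr1 sinDpi IH oppr0.
Qed.

(** The sign (-1)^(N v - N u), which records the parity of the number of jumps
    in (u, v]. The cosine makes it a continuous function of the increment, so
    its measurability in the random parameter is immediate. *)
Definition flip N u v : R := cos (pi * (N v - N u)).

Lemma flip_natE N u v (j k : nat) : N u = j%:R -> N v = k%:R ->
  flip N u v = (-1) ^+ (j + k).
Proof.
move=> Nu Nv; rewrite /flip Nu Nv mulrBr cosB !cos_pi_nat !sin_pi_nat.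
by rewrite mulr0 addr0 -exprD addnC.
Qed.

Lemma flipM N u v w :
  N u \is a Num.nat -> N v \is a Num.nat -> N w \is a Num.nat ->
  flip N v w * flip N u v = flip N u w.
Proof.
move=> /natrP[j Nu] /natrP[k Nv] /natrP[l Nw].
rewrite (flip_natE Nu Nv) (flip_natE Nv Nw) (flip_natE Nu Nw) -exprD.
rewrite -[LHS]signr_odd -[RHS]signr_odd !oddD.
by case: (odd j); case: (odd k); case: (odd l).
Qed.

Lemma flipC N u v : flip N u v = flip N v u.
Proof. by rewrite /flip -cosN -mulrN opprB. Qed.

Lemma natr_ltD1 u v : u \is a Num.nat -> v \is a Num.nat -> u < v -> u + 1 <= v.
Proof.
by move=> /natrP[j ->] /natrP[k ->]; rewrite ltr_nat natr1 ler_nat.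
Qed.

Lemma left_lim_cst (f : R -> R) u v c : u < v ->
  (forall w, u <= w < v -> f w = c) -> left_lim f v = c.
Proof.
move=> uv fc; apply: (lim_near_cst (@norm_hausdorff _ _)).
near=> w; apply: fc; apply/andP; split; near: w.
  exact: nbhs_left_ge.
exact: nbhs_left_lt.
Unshelve. all: by end_near. Qed.

End pathwise.

(** * Jumps of a counting path *)

Section counting.
Context {R : realType}.
Implicit Types (N Z D H : R -> R) (u v w e : R).

(** What almost every path of a Poisson process satisfies. *)
Definition counting_path N :=
  [/\ N 0 = 0, forall t, 0 <= t -> N t \is a Num.nat,
      forall u t, 0 <= u <= t -> N u <= N t
    & forall t, 0 <= t -> N x @[x --> t^'+] --> N t].

Definition jumps N u v : set R := [set w | u < w <= v /\ N w != left_lim N w].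

Lemma no_jump N u v : counting_path N -> 0 <= u -> N v = N u ->
  jumps N u v = set0.
Proof.
move=> [_ _ Nle _] u0 Nvu; apply/seteqP; split=> // w [/andP[uw wv]] /negP; apply.
have cst w' : u <= w' <= v -> N w' = N u.
  move=> /andP[uw' w'v]; apply/le_anti; rewrite -{1}Nvu !Nle ?u0//.
  by rewrite w'v (le_trans u0).
rewrite cst ?(ltW uw)//; apply/eqP/esym/(left_lim_cst uw) => w' /andP[uw' w'w].
by apply: cst; rewrite uw' (le_trans (ltW w'w)).
Qed.

(** The jump time is the supremum of the times at which N still has its initial
    value; right continuity gives N its new value at that very time. *)
Lemma single_jump N u v : counting_path N -> 0 <= u -> N v = N u + 1 -> u < v ->
  exists tau, [/\ u < tau <= v, forall w, u <= w < tau -> N w = N u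
    & forall w, tau <= w <= v -> N w = N u + 1].
Proof.
move=> [_ Nnat Nle Nr] u0 Nvu uv.
pose A := [set w | u <= w <= v /\ N w = N u].
have Au : A u by split=> //; rewrite lexx ltW.
have ubA : ubound A v by move=> w [/andP[]].
have supA : has_sup A by split; [exists u|exists v].
pose tau := sup A.
have utau : u <= tau by apply: sup_upper_bound.
have tauv : tau <= v by apply: ge_sup => //; exists u.
have before w : u <= w < tau -> N w = N u.
  move=> /andP[uw wtau].
  have tw0 : 0 < tau - w by rewrite subr_gt0.
  have [w' [/andP[uw' w'v] Nw']] := sup_adherent tw0 supA.
  rewrite -/tau subKr => ww'; apply/le_anti; rewrite -{1}Nw' !Nle ?u0//.
  by rewrite (ltW ww') (le_trans u0).
have after w : tau < w <= v -> N w = N u + 1.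
  move=> /andP[tw wv]; have uw : u < w by exact: le_lt_trans tw.
  apply/le_anti; rewrite -{1}Nvu Nle ?wv ?(le_trans u0 (ltW uw))//=.
  apply: natr_ltD1; rewrite ?Nnat// ?(le_trans u0 (ltW uw))//.
  rewrite lt_neqAle Nle ?u0 ?(ltW uw)// andbT; apply/eqP => Nuw.
  have : w <= tau by apply: sup_upper_bound => //; split; rewrite ?(ltW uw).
  by rewrite leNgt tw.
have tau0 : 0 <= tau := le_trans u0 utau.
have attau : N tau = N u + 1.
  have [tv|] := ltP tau v; last by move=> vt; rewrite -Nvu; congr N; lra.
  apply: (cvg_unique (@norm_hausdorff _ _) (Nr _ tau0)).
  apply: cvg_near_cst; near=> w; apply: after; apply/andP; split; near: w.
    exact: nbhs_right_gt.
  exact: nbhs_right_le.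
exists tau; split=> //.
  rewrite tauv andbT lt_neqAle utau andbT; apply/eqP => ut.
  by move: attau; rewrite -ut; lra.
move=> w /andP[]; rewrite le_eqVlt => /predU1P[<-//|tw wv].
by apply: after; rewrite tw.
Unshelve. all: by end_near. Qed.

Lemma jumps_single N u v tau : 0 <= u -> u < tau <= v ->
  (forall w, u <= w < tau -> N w = N u) ->
  (forall w, tau <= w <= v -> N w = N u + 1) ->
  jumps N u v = [set tau] /\ left_lim N tau = N u.
Proof.
move=> u0 /andP[ut tv] before after.
have lt : left_lim N tau = N u by exact: (left_lim_cst ut).
split=> //; apply/seteqP; split=> [w [/andP[uw wv]]|_ ->]; last first.
  split; first by rewrite ut.
  by rewrite lt after ?lexx//; apply/eqP; lra.
have [wt|tw|->//] := ltgtP w tau.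
  have lw : left_lim N w = N u.
    apply: (left_lim_cst uw) => w' /andP[uw' w'w].
    by apply: before; rewrite uw' (lt_trans w'w).
  by rewrite lw before ?eqxx// (ltW uw).
have lw : left_lim N w = N u + 1.
  apply: (left_lim_cst tw) => w' /andP[uw' w'w].
  by apply: after; rewrite uw' (le_trans (ltW w'w)).
by rewrite lw after ?eqxx// (ltW tw).
Qed.

Lemma jumpsU N u v w : u <= v -> v <= w -> jumps N u w = jumps N u v `|` jumps N v w.
Proof.
move=> uv vw; apply/seteqP; split=> [x [/andP[ux xw] Nx]|x].
  have [xv|vx] := leP x v; [left|right]; split=> //; first by rewrite ux.
  by rewrite vx.
by case=> -[/andP[h1 h2] Nx]; split=> //; apply/andP; split; lra.
Qed.

(** The finite-support sum defining [jump_integral] is only additive over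
    intervals with finitely many jumps; a subdivision whose cells contain at
    most one jump each provides this finiteness. *)
Lemma finite_jumps N (g : nat -> R) n : counting_path N -> g 0%N = 0 ->
  {homo g : i j / (i <= j)%N >-> i <= j} ->
  (forall k, (k < n)%N -> N (g k.+1) - N (g k) = 0 \/ N (g k.+1) - N (g k) = 1) ->
  finite_set (jumps N 0 (g n)).
Proof.
move=> cN g0 gle; elim: n => [|n IH] hn.
  rewrite g0 (_ : jumps _ _ _ = set0)//; apply/seteqP; split=> // x [].
  by case: ltgtP.
have gn0 : 0 <= g n by rewrite -g0 gle.
rewrite (jumpsU _ gn0 (gle _ _ (leqnSn n))) finite_setU; split.
  by apply: IH => k kn; apply: hn; exact: ltnW.
have [Nn|Nn] := hn _ (ltnSn n).
  by rewrite no_jump//; lra.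
have Ng : N (g n.+1) = N (g n) + 1 by lra.
have glt : g n < g n.+1.
  rewrite lt_neqAle gle// andbT; apply/eqP => gn; move: Nn; rewrite gn; lra.
have [tau [t1 t2 t3]] := single_jump cN gn0 Ng glt.
by have [-> _] := jumps_single gn0 t1 t2 t3.
Qed.

Lemma jump_integralE H N t :
  jump_integral H N t =
    \sum_(u \in jumps N 0 t) left_lim H u * (N u - left_lim N u).
Proof.
apply/esym/fsbig_widen => [x [/andP[x0 xt] _]|x [/=]].
  by rewrite /= in_itv/= x0.
rewrite in_itv/= => x0t nj.
have /eqP -> : N x == left_lim N x by apply/negPn/negP => h; apply: nj.
by rewrite subrr mulr0.
Qed.

Lemma jump_integral_add H N u v : 0 <= u -> u <= v -> finite_set (jumps N 0 v) ->
  jump_integral H N v = jump_integral H N u +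
    \sum_(w \in jumps N u v) left_lim H w * (N w - left_lim N w).
Proof.
move=> u0 uv; rewrite !jump_integralE (jumpsU _ u0 uv) finite_setU => -[f1 f2].
rewrite fsbigU0// => w [[/andP[_ h1] _] [/andP[h2 _] _]].
by move: (lt_le_trans h2 h1); rewrite ltxx.
Qed.

(** The left limits must exist, for [lim] of a divergent filter does not commute
    with the opposite. *)
Lemma jump_integralN H N t :
  (forall u, 0 < u -> cvg (H x @[x --> u^'-])) ->
  jump_integral (fun u => - H u) N t = - jump_integral H N t.
Proof.
move=> cH; rewrite -[RHS]mulN1r mulr_fsumr; apply: eq_fsbigr => u.
rewrite inE/= in_itv/= => /andP[u0 _]; rewrite mulN1r -mulNr; congr (_ * _).
by rewrite /left_lim limN//; exact: cH.
Qed.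

End counting.

(** * The Euler scheme of the pathwise equation *)

Section euler_scheme.
Context {R : realType}.
Implicit Types (N Z D H : R -> R) (u v w e t : R).

Lemma within_cvg_left Z (tau : R) : {within `[0, +oo[, continuous Z} -> 0 < tau ->
  Z x @[x --> tau^'-] --> Z tau.
Proof.
move=> /subspace_continuousP cZ tau0; apply/cvgrPdist_lt => e e0.
have /cZ/cvgrPdist_lt/(_ _ e0) : `[0, +oo[%classic tau.
  by rewrite /= in_itv/= andbT ltW.
rewrite near_withinE => /nbhs_ballP[r /= r0 hr].
near=> x; apply: hr; rewrite /ball/= ?in_itv/= ?andbT.
  rewrite gtr0_norm ?subr_gt0; near: x; first exact: nbhs_left_ltBl.
  exact: nbhs_left_lt.
by near: x; exact: nbhs_left_ge.
Unshelve. all: by end_near. Qed.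

(** On a cell with at most one jump, D is the sum of its flipped initial value
    and of the increment of Z, up to twice the oscillation of Z. Without jump
    this is exact. A jump at tau turns D_{tau-} = D_u + (Z_tau - Z_u) into its
    opposite, so the increment of Z before tau enters with the wrong sign; this
    is the whole error. *)
Lemma cell_step N Z D u v e : counting_path N ->
  {within `[0, +oo[, continuous Z} ->
  (forall w, 0 <= w -> D w = Z w - 2 * jump_integral D N w) ->
  0 <= u -> u <= v -> finite_set (jumps N 0 v) ->
  N v - N u = 0 \/ N v - N u = 1 ->
  (forall w, u <= w <= v -> `|Z w - Z u| <= e) ->
  `|D v - (flip N u v * D u + (Z v - Z u))| <= 2 * e * (N v - N u).
Proof.
move=> cN cZ DE u0 uv fj Nuv osc.
have v0 := le_trans u0 uv.
have const w : u <= w <= v -> N w = N u -> D w = D u + (Z w - Z u).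
  move=> /andP[uw wv] Nwu; rewrite !DE ?(le_trans u0)//.
  rewrite (jump_integral_add D u0 uw); last first.
    apply: sub_finite_set fj => x [/andP[x0 xw] Nx]; split=> //.
    by rewrite x0 (le_trans xw).
  by rewrite (no_jump cN u0 Nwu) fsbig_set0; ring.
have [Nvu|Nvu] := Nuv.
  rewrite Nvu mulr0 /flip Nvu mulr0 cos0 mul1r (const v) ?subrr ?normr0//.
    by rewrite uv lexx.
  by lra.
have Nvu1 : N v = N u + 1 by lra.
have ltuv : u < v.
  by rewrite lt_neqAle uv andbT; apply/eqP => h; move: Nvu1; rewrite h; lra.
have [tau [utv before after]] := single_jump cN u0 Nvu1 ltuv.
have [jE lN] := jumps_single u0 utv before after.
have /andP[ut tv] := utv.
have lD : left_lim D tau = D u + (Z tau - Z u).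
  apply/(cvg_lim (@norm_hausdorff _ _)).
  have : (D u + (Z x - Z u)) @[x --> tau^'-] --> D u + (Z tau - Z u).
    apply: cvgD; first exact: cvg_cst.
    apply: cvgB; last exact: cvg_cst.
    by apply: within_cvg_left => //; exact: le_lt_trans ut.
  apply: cvg_trans; apply: near_eq_cvg; near=> x.
  have utx : u <= x < tau.
    by apply/andP; split; near: x; [exact: nbhs_left_ge|exact: nbhs_left_lt].
  rewrite (const x) ?before//; case/andP: utx => ux xt.
  by rewrite ux (le_trans (ltW xt)).
rewrite (DE v)// (jump_integral_add D u0 uv fj) jE fsbig_set1 lD lN.
rewrite (after tau) ?lexx ?tv// (addrAC (N u)) subrr add0r mulr1.
rewrite Nvu mulr1 /flip Nvu mulr1 cospi.
have := DE u u0; have := osc tau; rewrite (ltW ut) tv => /(_ isT) ot Du.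
rewrite [X in `|X|](_ : _ = - 2 * (Z tau - Z u)); last by lra.
by rewrite normrM normrN (ger0_norm (ler0n _ 2)) ler_wpM2l.
Unshelve. all: by end_near. Qed.

(** The Riemann sum for the solution D_t = flip 0 t * Z_0 + int flip u t dZ_u of
    D = Z - 2 int D_- dN. *)
Definition euler N Z (g : nat -> R) (n : nat) t : R :=
  flip N 0 t * Z 0 +
  \sum_(k < n) flip N (g k.+1) t * (Z (g k.+1) - Z (g k)).

(** A cell contributes an error only if it contains a jump, and errors are carried
    forward with coefficients of modulus at most 1, so the total error is the
    oscillation times the number of jumps. *)
Lemma euler_error N Z D (g : nat -> R) n e : counting_path N ->
  {within `[0, +oo[, continuous Z} ->
  (forall w, 0 <= w -> D w = Z w - 2 * jump_integral D N w) ->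
  g 0%N = 0 -> {homo g : i j / (i <= j)%N >-> i <= j} ->
  (forall k, (k < n)%N -> N (g k.+1) - N (g k) = 0 \/ N (g k.+1) - N (g k) = 1) ->
  (forall k w, (k < n)%N -> g k <= w <= g k.+1 -> `|Z w - Z (g k)| <= e) ->
  `|D (g n) - euler N Z g n (g n)| <= 2 * e * N (g n).
Proof.
move=> cN cZ DE g0 gle; have [N0 Nnat _ _] := cN.
have gge k : 0 <= g k by rewrite -g0 gle.
elim: n => [|n IH] hn osc.
  rewrite g0 N0 mulr0 /euler big_ord0 addr0 /flip subrr mulr0 cos0 mul1r.
  rewrite DE// /jump_integral set_itv_ge ?bnd_simp ?ltxx// fsbig_set0.
  by rewrite mulr0 subr0 subrr normr0.
have {IH} IH := IH (fun k kn => hn k (ltnW kn)) (fun k w kn => osc k w (ltnW kn)).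
have fj := finite_jumps cN g0 gle hn.
have step := cell_step cN cZ DE (gge n) (gle _ _ (leqnSn n)) fj (hn n (ltnSn n))
  (fun w => osc n w (ltnSn n)).
have eulerS : euler N Z g n.+1 (g n.+1) =
    flip N (g n) (g n.+1) * euler N Z g n (g n) + (Z (g n.+1) - Z (g n)).
  rewrite /euler big_ord_recr/= [in RHS]mulrDr [in RHS]mulrA flipM ?Nnat// -addrA.
  congr (_ + _); rewrite mulr_sumr; congr (_ + _).
    by apply: eq_bigr => k _; rewrite mulrA flipM ?Nnat.
  by rewrite /flip subrr mulr0 cos0 mul1r.
rewrite eulerS.
set c := flip _ _ _ in step *; set E := euler _ _ _ _ _ in IH *.
have c1 : `|c| <= 1 by rewrite ler_norml cos_geN1 cos_le1.
have -> : D (g n.+1) - (c * E + (Z (g n.+1) - Z (g n))) =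
  (D (g n.+1) - (c * D (g n) + (Z (g n.+1) - Z (g n)))) + c * (D (g n) - E).
  by ring.
apply: le_trans (ler_normD _ _) _; rewrite normrM.
have : `|c| * `|D (g n) - E| <= `|D (g n) - E| by rewrite ler_piMl.
lra.
Qed.

Definition grid t (j k : nat) : R := t * k%:R / (2 ^ j)%:R.

Lemma grid0 t j : grid t j 0 = 0.
Proof. by rewrite /grid mulr0 mul0r. Qed.

Lemma pow2_gt0 j : 0 < (2 ^ j)%:R :> R.
Proof. by rewrite ltr0n expn_gt0. Qed.

Lemma grid_last t j : grid t j (2 ^ j) = t.
Proof. by rewrite /grid mulfK// gt_eqF ?pow2_gt0. Qed.

Lemma grid_homo t j : 0 <= t -> {homo grid t j : i k / (i <= k)%N >-> i <= k}.
Proof.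
move=> t0 i k ik; rewrite /grid ler_wpM2r ?invr_ge0 ?ler0n//.
by rewrite ler_wpM2l ?ler_nat.
Qed.

Lemma grid_refine t i j k : grid t i k = grid t (i + j) (k * 2 ^ j).
Proof.
by rewrite /grid expnD !natrM; field; rewrite !gt_eqF ?pow2_gt0.
Qed.

Lemma gridS t j k : grid t j k.+1 - grid t j k = t / (2 ^ j)%:R.
Proof. by rewrite /grid -natr1; field; rewrite gt_eqF ?pow2_gt0. Qed.

Lemma grid_parent t i j l : 0 <= t ->
  grid t i (l %/ 2 ^ j) <= grid t (i + j) l /\
  grid t (i + j) l.+1 <= grid t i (l %/ 2 ^ j).+1.
Proof.
move=> t0; rewrite !(grid_refine t i j); split; apply: grid_homo => //.
  exact: leq_trunc_div.
by rewrite ltn_ceil// expn_gt0.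
Qed.

(** If some dyadic level separates the jumps, so do all finer ones, and the mesh
    tending to 0 makes the oscillation of Z on the cells uniformly small. *)
Lemma euler_cvg N Z D t : counting_path N -> {within `[0, +oo[, continuous Z} ->
  (forall w, 0 <= w -> D w = Z w - 2 * jump_integral D N w) -> 0 < t ->
  (exists i, forall k, (k < 2 ^ i)%N ->
    N (grid t i k.+1) - N (grid t i k) = 0 \/
    N (grid t i k.+1) - N (grid t i k) = 1) ->
  euler N Z (grid t j) (2 ^ j) t @[j --> \oo] --> D t.
Proof.
move=> cN cZ DE t0 [i hi]; apply/cvgrPdist_le => e e0.
have [N0 Nnat Nle _] := cN.
have Nt0 : 0 <= N t by rewrite -N0 Nle// lexx ltW.
pose e' := e / (2 * (N t + 1)).
have e'0 : 0 < e' by rewrite divr_gt0// mulr_gt0// ltr_wpDl.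
have [dl dl0 hdl] := heine_segment t cZ e'0.
have [n0 hn0] : exists n0, forall j, (n0 <= j)%N -> t / (2 ^ j)%:R < dl.
  have : t / (2 ^ j)%:R @[j --> \oo] --> 0.
    rewrite -[X in _ --> X](mulr0 t); under eq_fun do rewrite natrX -exprVn.
    by apply: cvgMr; apply: cvg_expr; rewrite ger0_norm ?invf_lt1 ?ltr1n// invr_ge0.
  move=> /cvgrPdist_lt/(_ _ dl0)[n0 _ hn]; exists n0 => j /hn /=.
  by rewrite sub0r normrN gtr0_norm// divr_gt0 ?pow2_gt0.
near=> j.
have ij : (i <= j)%N by near: j; exact: nbhs_infty_ge.
have nj : (n0 <= j)%N by near: j; exact: nbhs_infty_ge.
rewrite -{1 3}(grid_last t j).
have t0' := ltW t0.
have gh := @grid_homo t j t0'.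
apply: (le_trans (@euler_error N Z D (grid t j) (2 ^ j) e' cN cZ DE (grid0 t j) gh _ _)).
- move=> k kj; have [l lE] : exists l, j = (i + l)%N by exists (j - i)%N; rewrite subnKC.
  have k'i : (k %/ 2 ^ l < 2 ^ i)%N.
    by rewrite ltn_divLR ?expn_gt0// -expnD -lE.
  have [p1 p2] := grid_parent i l k t0'.
  have gg m n' : 0 <= grid t m n' by rewrite -(grid0 t m) grid_homo.
  have n1 : N (grid t i (k %/ 2 ^ l)) <= N (grid t j k) by rewrite Nle// gg lE.
  have n2 : N (grid t j k) <= N (grid t j k.+1) by rewrite Nle// gg grid_homo.
  have n3 : N (grid t j k.+1) <= N (grid t i (k %/ 2 ^ l).+1) by rewrite Nle// gg lE.
  have n4 := hi _ k'i.
  have [lt|] := ltP (N (grid t j k)) (N (grid t j k.+1)); last by left; lra.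
  by have := natr_ltD1 (Nnat _ (gg _ _)) (Nnat _ (gg _ _)) lt; right; lra.
- move=> k w kj /andP[gw wg].
  have g0 : 0 <= grid t j k by rewrite -(grid0 t j) grid_homo.
  have gt : grid t j k.+1 <= t by rewrite -{2}(grid_last t j) grid_homo.
  apply/ltW; apply: hdl; rewrite ?g0//; first by apply/andP; split; lra.
  have := hn0 _ nj; rewrite -(gridS t j k) => ?.
  by rewrite ger0_norm; lra.
rewrite grid_last /e' -[leRHS]mulr1.
have -> : 2 * (e / (2 * (N t + 1))) * N t = e * (N t / (N t + 1)).
  by field; rewrite gt_eqF// ltr_wpDl.
by rewrite ler_wpM2l ?(ltW e0)// ler_pdivrMr ?ltr_wpDl// mul1r lerDl.
Unshelve. all: by end_near. Qed.

End euler_scheme.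

(** * Expectations and square integrability *)

Section moments.
Context d (T : measurableType d) (R : realType) (P : probability T R).
Implicit Types f g h : T -> R.

Definition L1 f := P.-integrable setT (EFin \o f).

(** Measurability has to be required besides the integrability of the square,
    which loses the sign. *)
Definition L2 f := measurable_fun setT f /\ L1 (fun w => f w ^+ 2).

Definition bounded_rv f :=
  measurable_fun setT f /\ exists K : R, forall w, `|f w| <= K.

(** The real-valued expectation, for which linearity and [ring] are available;
    [ExE] links it to the extended one. *)
Definition Ex f : R := (\int[P]_w f w)%R.

Lemma L1_measurable f : L1 f -> measurable_fun setT f.
Proof. by move=> /integrableP[/measurable_EFinP]. Qed.

Lemma L1_le f g : measurable_fun setT f -> L1 g -> (forall w, `|f w| <= `|g w|) ->
  L1 f.
Proof.
move=> mf ig fg; apply: le_integrable ig => //; first exact/measurable_EFinP.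
by move=> w _; rewrite lee_fin.
Qed.

Lemma L1D f g : L1 f -> L1 g -> L1 (fun w => f w + g w).
Proof. by move=> fi gi; apply: eq_integrable (integrableD _ fi gi). Qed.

Lemma L1Z c f : L1 f -> L1 (fun w => c * f w).
Proof. by move=> fi; apply: eq_integrable (integrableZl _ c fi). Qed.

Lemma L1N f : L1 f -> L1 (fun w => - f w).
Proof. by move=> fi; apply: eq_integrable (integrableN fi). Qed.

Lemma L1B f g : L1 f -> L1 g -> L1 (fun w => f w - g w).
Proof. by move=> fi gi; apply: L1D => //; exact: L1N. Qed.

Lemma L1_cst c : L1 (cst c).
Proof. exact: finite_measure_integrable_cst. Qed.

Lemma L1_sum n (F : 'I_n -> T -> R) : (forall i, L1 (F i)) ->
  L1 (fun w => \sum_(i < n) F i w).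
Proof.
elim: n F => [|n IH] F FL.
  by under [X in L1 X]eq_fun do rewrite big_ord0; exact: L1_cst.
under [X in L1 X]eq_fun do rewrite big_ord_recr/=.
by apply: L1D => //; exact: IH.
Qed.

Lemma ExE f : L1 f -> 'E_P[f]%E = (Ex f)%:E.
Proof.
move=> fi; rewrite unlock /Ex /Rintegral fineK//.
exact: integrable_fin_num.
Qed.

Lemma ExD f g : L1 f -> L1 g -> Ex (fun w => f w + g w) = Ex f + Ex g.
Proof. by move=> fi gi; rewrite /Ex RintegralD. Qed.

Lemma ExB f g : L1 f -> L1 g -> Ex (fun w => f w - g w) = Ex f - Ex g.
Proof. by move=> fi gi; rewrite /Ex RintegralB. Qed.

Lemma ExZ c f : L1 f -> Ex (fun w => c * f w) = c * Ex f.
Proof. by move=> fi; rewrite /Ex RintegralZl. Qed.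

Lemma Ex_cst c : Ex (cst c) = c.
Proof. by rewrite /Ex Rintegral_cst//= probability_setT mulr1. Qed.

Lemma Ex_sum n (F : 'I_n -> T -> R) : (forall i, L1 (F i)) ->
  Ex (fun w => \sum_(i < n) F i w) = \sum_(i < n) Ex (F i).
Proof.
elim: n F => [|n IH] F FL.
  under [in LHS]eq_fun do rewrite big_ord0.
  by rewrite big_ord0 -[RHS](Ex_cst 0).
under [in LHS]eq_fun do rewrite big_ord_recr/=.
rewrite ExD//; last by apply: L1_sum => i; exact: FL.
by rewrite IH// big_ord_recr.
Qed.

Lemma Ex_ge0 f : (forall w, 0 <= f w) -> 0 <= Ex f.
Proof. by move=> f0; apply: Rintegral_ge0. Qed.

Lemma Ex_le f g : L1 f -> L1 g -> (forall w, f w <= g w) -> Ex f <= Ex g.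
Proof. by move=> fi gi fg; apply: le_Rintegral. Qed.

Lemma L1_ae f g : measurable_fun setT f -> measurable_fun setT g ->
  {ae P, forall w, f w = g w} -> L1 f -> L1 g /\ Ex f = Ex g.
Proof.
move=> /measurable_EFinP mf /measurable_EFinP mg fg fi.
have fgE : ae_eq P setT (EFin \o f) (EFin \o g).
  by apply: filterS fg => w fgw _ /=; rewrite fgw.
split; last by rewrite /Ex /Rintegral (ae_eq_integral (EFin \o g)).
apply/integrableP; split=> //; move/integrableP: fi => [_].
rewrite (ge0_ae_eq_integral (g := fun x => `|(EFin \o g) x|%E))//; last first.
  by apply: filterS fg => w fgw _ /=; rewrite fgw.
- exact: measurableT_comp.
- exact: measurableT_comp.
Qed.

Lemma L2_measurable f : L2 f -> measurable_fun setT f. Proof. by case. Qed.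

Lemma L2M f g : L2 f -> L2 g -> L1 (fun w => f w * g w).
Proof.
move=> [mf f2] [mg g2]; apply: (L1_le _ (L1D f2 g2)).
  exact: measurable_funM.
move=> w; rewrite (ger0_norm (addr_ge0 (sqr_ge0 _) (sqr_ge0 _))).
rewrite ler_norml; apply/andP; split; nra.
Qed.

Lemma L2D f g : L2 f -> L2 g -> L2 (fun w => f w + g w).
Proof.
move=> Lf Lg; split; first by apply: measurable_funD; [case: Lf|case: Lg].
apply: (eq_integrable _ (EFin \o
    (fun w => (f w ^+ 2 + 2 * (f w * g w)) + g w ^+ 2))) => //.
  by move=> w _ /=; congr EFin; ring.
apply: L1D; last by case: Lg.
by apply: L1D; [case: Lf|apply: L1Z; exact: L2M].
Qed.

Lemma L2Z c f : L2 f -> L2 (fun w => c * f w).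
Proof.
move=> Lf; split; first by apply: measurable_funM => //; case: Lf.
apply: (eq_integrable _ (EFin \o (fun w => c ^+ 2 * f w ^+ 2))) => //.
  by move=> w _ /=; congr EFin; ring.
by apply: L1Z; case: Lf.
Qed.

Lemma L2B f g : L2 f -> L2 g -> L2 (fun w => f w - g w).
Proof.
move=> Lf Lg; have := L2D Lf (L2Z (- 1) Lg).
by under [X in L2 X -> _]eq_fun do rewrite mulN1r.
Qed.

Lemma L2_cst c : L2 (cst c).
Proof. by split; [exact: measurable_cst|exact: (L1_cst (c ^+ 2))]. Qed.

Lemma L2_sum n (F : 'I_n -> T -> R) : (forall i, L2 (F i)) ->
  L2 (fun w => \sum_(i < n) F i w).
Proof.
elim: n F => [|n IH] F FL.
  by under [X in L2 X]eq_fun do rewrite big_ord0; exact: L2_cst.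
under [X in L2 X]eq_fun do rewrite big_ord_recr/=.
by apply: L2D => //; exact: IH.
Qed.

Lemma L2_L1 f : L2 f -> L1 f.
Proof.
move=> Lf; have := L2M Lf (L2_cst 1).
by under [X in L1 X -> _]eq_fun do rewrite mulr1.
Qed.

Lemma L1_bdM f g : bounded_rv f -> L1 g -> L1 (fun w => f w * g w).
Proof.
move=> [mf [K fK]] gi; apply: (L1_le _ (L1Z K gi)).
  by apply: measurable_funM => //; exact: L1_measurable.
move=> w; rewrite !normrM ler_wpM2r// (le_trans (fK w))//.
exact: ler_norm.
Qed.

Lemma bd_cst c : bounded_rv (cst c).
Proof. by split; [exact: measurable_cst|exists `|c|]. Qed.

Lemma bdM f g : bounded_rv f -> bounded_rv g -> bounded_rv (fun w => f w * g w).
Proof.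
move=> [mf [K fK]] [mg [K' gK]]; split; first exact: measurable_funM.
by exists (K * K') => w; rewrite normrM ler_pM.
Qed.

Lemma bdD f g : bounded_rv f -> bounded_rv g -> bounded_rv (fun w => f w + g w).
Proof.
move=> [mf [K fK]] [mg [K' gK]]; split; first exact: measurable_funD.
by exists (K + K') => w; rewrite (le_trans (ler_normD _ _))// lerD.
Qed.

Lemma bdB f g : bounded_rv f -> bounded_rv g -> bounded_rv (fun w => f w - g w).
Proof.
move=> bf [mg [K gK]]; apply: (bdD bf); split.
  exact: measurableT_comp.
by exists K => w; rewrite normrN.
Qed.

Lemma bd_sum n (F : 'I_n -> T -> R) : (forall i, bounded_rv (F i)) ->
  bounded_rv (fun w => \sum_(i < n) F i w).
Proof.
elim: n F => [|n IH] F FL.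
  by under [X in bounded_rv X]eq_fun do rewrite big_ord0; exact: bd_cst.
under [X in bounded_rv X]eq_fun do rewrite big_ord_recr/=.
by apply: bdD => //; exact: IH.
Qed.

Lemma bd_L1 f : bounded_rv f -> L1 f.
Proof.
move=> bf; have := L1_bdM bf (L1_cst 1).
by under [X in L1 X -> _]eq_fun do rewrite mulr1.
Qed.

Lemma L2_bdM f g : bounded_rv f -> L2 g -> L2 (fun w => f w * g w).
Proof.
move=> bf [mg g2]; split; first by apply: measurable_funM => //; case: bf.
apply: (eq_integrable _ (EFin \o (fun w => (f w * f w) * g w ^+ 2))) => //.
  by move=> w _ /=; congr EFin; ring.
by apply: L1_bdM => //; exact: bdM.
Qed.

Lemma bd_L2 f : bounded_rv f -> L2 f.
Proof. by move=> bf; split; [case: bf|apply/bd_L1/bdM]. Qed.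

End moments.

(** * Independence and products *)

Section independence.
Context d (T : measurableType d) (R : realType) (P : probability T R).

Definition indep2 d1 d2 (T1 : measurableType d1) (T2 : measurableType d2)
    (f : T -> T1) (g : T -> T2) :=
  forall (A : set T1) (B : set T2), measurable A -> measurable B ->
  P (f @^-1` A `&` g @^-1` B) = (P (f @^-1` A) * P (g @^-1` B))%E.

(** The law of (f, g) is the product of the laws of f and g, because both agree
    on rectangles; the identity is then Tonelli's theorem. *)
Lemma indep2_integral d1 d2 (T1 : measurableType d1) (T2 : measurableType d2)
    (f : T -> T1) (g : T -> T2) (k : T1 * T2 -> \bar R) :
  measurable_fun setT f -> measurable_fun setT g -> indep2 f g ->
  measurable_fun [set: T1 * T2] k -> (forall z, (0 <= k z)%E) ->
  (\int[P]_w k (f w, g w) = \int[P]_w \int[P]_w' k (f w, g w'))%E.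
Proof.
move=> mf mg fg mk k0.
have mfg : measurable_fun setT (fun w => (f w, g w)) by exact: measurable_fun_pair.
pose F : {mfun T >-> T1} := HB.pack f (isMeasurableFun.Build _ _ _ _ f mf).
pose G : {mfun T >-> T2} := HB.pack g (isMeasurableFun.Build _ _ _ _ g mg).
pose FG : {mfun T >-> (T1 * T2)%type} :=
  HB.pack (fun w => (f w, g w)) (isMeasurableFun.Build _ _ _ _ _ mfg).
pose m1 := distribution P F; pose m2 := distribution P G.
have -> : (\int[P]_w k (f w, g w) = \int[distribution P FG]_z k z)%E.
  by rewrite ge0_integral_pushforward//.
have uniq A : measurable A -> distribution P FG A = (m1 \x m2)%E A.
  move=> mA; apply/esym; apply: product_measure_unique mA => B C mB mC.
  by rewrite /m1 /m2 /distribution /pushforward/= -fg//.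
rewrite (eq_measure_integral (m1 \x m2)%E); last by move=> A mA _; exact: uniq.
rewrite fubini_tonelli1//.
rewrite ge0_integral_pushforward//=; last first.
- by move=> y _; apply: integral_ge0.
- exact: measurable_fun_fubini_tonelli_F.
rewrite preimage_setT; apply: eq_integral => w _ /=.
rewrite /fubini_F ge0_integral_pushforward//.
by apply: measurableT_comp => //; exact: measurable_fun_pair.
Qed.

Lemma indep2_comp d1 d2 d3 d4 (T1 : measurableType d1) (T2 : measurableType d2)
    (T3 : measurableType d3) (T4 : measurableType d4)
    (f : T -> T1) (g : T -> T2) (phi : T1 -> T3) (psi : T2 -> T4) :
  measurable_fun setT phi -> measurable_fun setT psi ->
  indep2 f g -> indep2 (phi \o f) (psi \o g).
Proof.
move=> mphi mpsi fg A B mA mB.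
have mA' : measurable (phi @^-1` A) by rewrite -[X in measurable X]setTI; exact: mphi.
have mB' : measurable (psi @^-1` B) by rewrite -[X in measurable X]setTI; exact: mpsi.
exact: (fg _ _ mA' mB').
Qed.

Lemma indep2_integral_abs (f g : T -> R) : L1 P f -> L1 P g -> indep2 f g ->
  (\int[P]_w (`|f w| * `|g w|)%:E =
   (\int[P]_w `|f w|%:E) * (\int[P]_w `|g w|%:E))%E.
Proof.
move=> Lf Lg fg; have mf := L1_measurable Lf; have mg := L1_measurable Lg.
rewrite (@indep2_integral _ _ _ _ f g
  (fun z => (`|z.1| * `|z.2|)%:E))//; last first.
  apply/measurable_EFinP; apply: measurable_funM.
    by apply: measurableT_comp => //; exact: measurable_fst.
  by apply: measurableT_comp => //; exact: measurable_snd.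
have mgE : measurable_fun setT (fun w => `|g w|%:E).
  by apply/measurable_EFinP; exact: measurableT_comp.
have mfE : measurable_fun setT (fun w => `|f w|%:E).
  by apply/measurable_EFinP; exact: measurableT_comp.
under eq_integral => w _.
  under eq_integral do rewrite /= EFinM.
  rewrite ge0_integralZl//; over.
rewrite /= ge0_integralZr//; exact: integral_ge0.
Qed.

Lemma indep2_L1 (f g : T -> R) : L1 P f -> L1 P g -> indep2 f g ->
  L1 P (fun w => f w * g w).
Proof.
move=> Lf Lg fg; apply/integrableP; split.
  by apply/measurable_EFinP/measurable_funM; exact: (@L1_measurable _ _ _ P).
under eq_integral do rewrite /= normrM.
rewrite indep2_integral_abs//.
move/integrableP: Lf => [_ Lf]; move/integrableP: Lg => [_ Lg].
by rewrite lte_mul_pinfty// ?integral_ge0// ge0_fin_numE// integral_ge0.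
Qed.

(** Tonelli handles nonnegative factors. In general write u = (|u| + u) - |u|:
    both terms are nonnegative functions of u, so independence is kept. *)
Lemma indep2_Ex (f g : T -> R) : L1 P f -> L1 P g -> indep2 f g ->
  Ex P (fun w => f w * g w) = Ex P f * Ex P g.
Proof.
have pos (u v : T -> R) : L1 P u -> L1 P v -> indep2 u v ->
    (forall w, 0 <= u w) -> (forall w, 0 <= v w) ->
    Ex P (fun w => u w * v w) = Ex P u * Ex P v.
  move=> Lu Lv uv u0 v0; have := indep2_integral_abs Lu Lv uv.
  under eq_integral do rewrite !ger0_norm//.
  under [X in _ = (X * _)%E]eq_integral do rewrite !ger0_norm//.
  under [X in _ = (_ * X)%E]eq_integral do rewrite !ger0_norm//.
  by rewrite /Ex /Rintegral => ->; rewrite fineM//; exact: integrable_fin_num.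
move=> Lf Lg fg.
have Labs (u : T -> R) : L1 P u -> L1 P (fun w => `|u w|).
  move=> Lu; apply: (L1_le _ Lu) => [|w]; last by rewrite normr_id.
  by apply: measurableT_comp => //; exact: (@L1_measurable _ _ _ P).
pose p (x : R) : R := `|x| + x.
have p0 x : 0 <= p x by rewrite /p; have := ler_norm (- x); rewrite normrN; lra.
have mp : measurable_fun [set: R] p by exact: measurable_funD.
pose n (x : R) : R := `|x|.
have mn : measurable_fun [set: R] n by exact: normr_measurable.
have Lp (u : T -> R) : L1 P u -> L1 P (p \o u) by move=> Lu; apply: L1D => //; exact: Labs.
have Ln (u : T -> R) : L1 P u -> L1 P (n \o u) by exact: Labs.
have dec (u : T -> R) : L1 P u -> Ex P u = Ex P (p \o u) - Ex P (n \o u).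
  move=> Lu; rewrite -ExB; [|exact: Lp|exact: Ln].
  by congr Ex; apply/funext => w /=; rewrite /p /n; ring.
have pp := indep2_comp mp mp fg; have pn := indep2_comp mp mn fg.
have np := indep2_comp mn mp fg; have nn := indep2_comp mn mn fg.
have Lpp := indep2_L1 (Lp _ Lf) (Lp _ Lg) pp.
have Lpn := indep2_L1 (Lp _ Lf) (Ln _ Lg) pn.
have Lnp := indep2_L1 (Ln _ Lf) (Lp _ Lg) np.
have Lnn := indep2_L1 (Ln _ Lf) (Ln _ Lg) nn.
have -> : (fun w => f w * g w) = (fun w =>
    ((p \o f) w * (p \o g) w - (p \o f) w * (n \o g) w) -
    ((n \o f) w * (p \o g) w - (n \o f) w * (n \o g) w)).
  by apply/funext => w /=; rewrite /p /n; ring.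
rewrite (ExB (L1B Lpp Lpn) (L1B Lnp Lnn)) (ExB Lpp Lpn) (ExB Lnp Lnn).
rewrite (dec f Lf) (dec g Lg).
have p0' (u : T -> R) w : 0 <= (p \o u) w by exact: p0.
have n0' (u : T -> R) w : 0 <= (n \o u) w by exact: normr_ge0.
rewrite (pos _ _ (Lp _ Lf) (Lp _ Lg) pp (p0' f) (p0' g)).
rewrite (pos _ _ (Lp _ Lf) (Ln _ Lg) pn (p0' f) (n0' g)).
rewrite (pos _ _ (Ln _ Lf) (Lp _ Lg) np (n0' f) (p0' g)).
rewrite (pos _ _ (Ln _ Lf) (Ln _ Lg) nn (n0' f) (n0' g)).
by rewrite mulrBl !mulrBr.
Qed.

Definition indep3 d1 d2 d3 (T1 : measurableType d1) (T2 : measurableType d2)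
    (T3 : measurableType d3) (f : T -> T1) (g : T -> T2) (h : T -> T3) :=
  forall (A : set T1) (B : set T2) (C : set T3),
    measurable A -> measurable B -> measurable C ->
  P (f @^-1` A `&` (g @^-1` B `&` h @^-1` C)) =
    (P (f @^-1` A) * (P (g @^-1` B) * P (h @^-1` C)))%E.

Lemma indep3_indep2 d1 d2 d3 (T1 : measurableType d1) (T2 : measurableType d2)
    (T3 : measurableType d3) (f : T -> T1) (g : T -> T2) (h : T -> T3) :
  indep3 f g h -> indep2 g h.
Proof.
move=> fgh B C mB mC; have := fgh _ _ _ (@measurableT _ T1) mB mC.
by rewrite preimage_setT setTI probability_setT mul1e.
Qed.

(** For fixed A both sides are finite measures in B, and they agree on the
    rectangles, which generate the product sigma-algebra and are stable under
    intersection. *)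
Lemma indep3_pair d1 d2 d3 (T1 : measurableType d1) (T2 : measurableType d2)
    (T3 : measurableType d3) (f : T -> T1) (g : T -> T2) (h : T -> T3) :
  measurable_fun setT f -> measurable_fun setT g -> measurable_fun setT h ->
  indep3 f g h -> indep2 f (fun w => (g w, h w)).
Proof.
move=> mf mg mh fgh A B mA mB; have gh := indep3_indep2 fgh.
have mfA : measurable (f @^-1` A) by rewrite -[X in measurable X]setTI; exact: mf.
have mgh : measurable_fun setT (fun w => (g w, h w)) by exact: measurable_fun_pair.
pose GH : {mfun T >-> (T2 * T3)%type} :=
  HB.pack (fun w => (g w, h w)) (isMeasurableFun.Build _ _ _ _ _ mgh).
have PA0 : 0 <= fine (P (f @^-1` A)) by rewrite fine_ge0.
pose c : {nonneg R} := NngNum PA0.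
pose m1 := measure_function_pushforward__canonical__measure_function_Measure
  (mrestr P mfA) mgh.
pose m2 := mscale c (distribution P GH).
have -> : P (f @^-1` A) = (fine (P (f @^-1` A)))%:E by rewrite fineK ?fin_num_measure.
pose G := [set B `*` C | B in @measurable _ T2 & C in @measurable _ T3].
suff : m1 B = m2 B by rewrite setIC.
apply: (@measure_unique _ _ _ G (fun=> setT)) => //.
- exact: measurable_prod_measurableType.
- move=> _ _ [B1 mB1 [C1 mC1 <-]] [B2 mB2 [C2 mC2 <-]].
  exists (B1 `&` B2); first exact: measurableI.
  by exists (C1 `&` C2); [exact: measurableI|rewrite setXI].
- by move=> _; exists setT => //; exists setT => //; rewrite setXTT.
- by rewrite bigcup_const//; exists 0%N.
- move=> _ [B1 mB1 [C1 mC1 <-]].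
  have -> : m1 (B1 `*` C1) = P (f @^-1` A `&` (g @^-1` B1 `&` h @^-1` C1)).
    by rewrite setIC.
  transitivity ((fine (P (f @^-1` A)))%:E * P (g @^-1` B1 `&` h @^-1` C1))%E => //.
  by rewrite fgh// gh// fineK ?fin_num_measure.
- move=> _; apply: le_lt_trans (ltry 1); apply: probability_le1.
  by apply: measurableI => //; rewrite preimage_setT.
Qed.

End independence.

(** * Moments of the centred normal law *)

Section normal_moments.
Context {R : realType}.
Variable sd : R.
Hypothesis sd0 : 0 < sd.
Let mu : {measure set _ -> \bar R} := @lebesgue_measure R.
Let pdf : R -> R := normal_pdf 0 sd.
Let nu : probability (measurableTypeR R) R := normal_prob 0 sd.

Let sdn0 : sd != 0. Proof. by rewrite gt_eqF. Qed.

Lemma normal_pdf0E x : pdf x = normal_peak sd * expR (- x ^+ 2 / (sd ^+ 2 *+ 2)).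
Proof. by rewrite /pdf normal_pdfE//= /normal_fun subr0. Qed.

Lemma integral_normal_prob (g : R -> \bar R) : (forall x, (0 <= g x)%E) ->
  measurable_fun setT g ->
  (\int[nu]_x g x = \int[mu]_x (g x * (pdf x)%:E))%E.
Proof.
move=> g0 mg; have dom := normal_prob_dominates (0 : R) sd.
rewrite -(Radon_Nikodym_SigmaFinite.change_of_variables dom)//.
have fi := Radon_Nikodym_SigmaFinite.f_integrable dom.
apply: ae_eq_integral => //.
- by apply: emeasurable_funM => //; exact: measurable_int fi.
- apply: emeasurable_funM => //; apply/measurable_EFinP.
  exact: measurable_normal_pdf.
apply: ae_eqe_mul2l => /=; apply: integral_ae_eq => //=.
- by apply/measurable_EFinP; exact: measurable_normal_pdf.
- by move=> E _ mE; rewrite -Radon_Nikodym_SigmaFinite.f_integral.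
Qed.

Lemma pdf_ge0 x : 0 <= pdf x. Proof. exact: normal_pdf_ge0. Qed.

Lemma pdf_continuous : continuous pdf.
Proof. exact: continuous_normal_pdf. Qed.

Lemma pdf_even x : pdf (- x) = pdf x.
Proof. by rewrite !normal_pdf0E sqrrN. Qed.

Lemma pdf_derive (x : R) : is_derive x 1 pdf (- x / sd ^+ 2 * pdf x).
Proof.
have -> : pdf = (fun x => normal_peak sd * expR (- x ^+ 2 / (sd ^+ 2 *+ 2))).
  by apply/funext => y; rewrite normal_pdf0E.
apply: is_derive_eq; rewrite /GRing.scale/=; field.
by rewrite sdn0.
Qed.

(** An antiderivative of (x^2 - sd^2) pdf which vanishes at 0 and at infinity:
    this is why the second moment is sd^2 times the total mass. *)
Let F (x : R) : R := - (sd ^+ 2 * x * pdf x).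

Let dF (x : R) : is_derive x 1 F ((x ^+ 2 - sd ^+ 2) * pdf x).
Proof.
have := pdf_derive x => H.
apply: is_derive_eq; rewrite /GRing.scale/=; field.
by rewrite sdn0.
Qed.

Let F_cvgy : F x @[x --> +oo] --> 0.
Proof.
have [C C0 hC] : exists2 C, 0 <= C & forall x, 0 < x -> `|F x| <= C * x^-1.
  exists (sd ^+ 2 * normal_peak sd * (2 * sd ^+ 2)) => [|x x0].
    by rewrite !mulr_ge0 ?exprn_ge0 ?normal_peak_ge0// ltW.
  rewrite /F normrN ger0_norm; last first.
    by rewrite !mulr_ge0 ?exprn_ge0 ?pdf_ge0// ltW.
  rewrite normal_pdf0E.
  set y := x ^+ 2 / (sd ^+ 2 *+ 2).
  have y0 : 0 < y by rewrite divr_gt0 ?exprn_gt0// mulrn_wgt0// exprn_gt0.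
  have ey : expR (- x ^+ 2 / (sd ^+ 2 *+ 2)) <= y^-1.
    rewrite mulNr expRN lef_pV2 ?posrE ?expR_gt0//.
    by apply: le_trans (expR_ge1Dx _); rewrite lerDr.
  have -> : sd ^+ 2 * normal_peak sd * (2 * sd ^+ 2) * x^-1 =
      sd ^+ 2 * x * normal_peak sd * y^-1.
    by rewrite /y; field; rewrite sdn0 gt_eqF.
  by rewrite mulrA ler_wpM2l// !mulr_ge0 ?exprn_ge0 ?normal_peak_ge0// ltW.
apply/cvgr0Pnorm_le => e e0; near=> x.
have x0 : 0 < x by near: x; exact: nbhs_pinfty_gt.
have xC : C / e <= x by near: x; apply: nbhs_pinfty_ge; rewrite num_real.
by rewrite (le_trans (hC _ x0))// ler_pdivrMr// mulrC -ler_pdivrMr.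
Unshelve. all: by end_near. Qed.

Let Fder (x : R) : derive1 F x = (x ^+ 2 - sd ^+ 2) * pdf x.
Proof. by rewrite derive1E; apply: derive_val. Qed.

Let Fcont : continuous F.
Proof.
by move=> x; apply: differentiable_continuous; apply/derivable1_diffP; case: (dF x).
Qed.

Let fcont : continuous (fun x : R => (x ^+ 2 - sd ^+ 2) * pdf x).
Proof.
move=> x; apply: cvgM; last exact: pdf_continuous.
by apply: cvgB; [exact: exprn_continuous|exact: cvg_cst].
Qed.

Let x2pdf_ge0 x : (0 <= (x ^+ 2 * pdf x)%:E)%E.
Proof. by rewrite lee_fin mulr_ge0 ?sqr_ge0// pdf_ge0. Qed.

Let mpdf : measurable_fun [set: R] pdf. Proof. exact: measurable_normal_pdf. Qed.

Let mx2pdf : measurable_fun [set: R] (fun x => (x ^+ 2 * pdf x)%:E).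
Proof. by apply/measurable_EFinP/measurable_funM => //; exact: measurable_funX. Qed.

(** The fundamental theorem on an unbounded interval asks for an integrand of
    constant sign, and x^2 - sd^2 changes sign at sd: the half line is cut there,
    and only nonnegative integrands are ever added. *)
Let tail : (\int[mu]_(x in `[sd, +oo[) (x ^+ 2 * pdf x)%:E =
  (- F sd)%:E + (sd ^+ 2)%:E * \int[mu]_(x in `[sd, +oo[) (pdf x)%:E)%E.
Proof.
have f0 x : sd <= x -> 0 <= (x ^+ 2 - sd ^+ 2) * pdf x.
  move=> sx; rewrite mulr_ge0 ?pdf_ge0// subr_ge0 ler_pXn2r ?nnegrE// ?ltW//.
  exact: lt_le_trans sx.
have := @ge0_continuous_FTC2y R _ F sd 0 f0 (continuous_subspaceT fcont) F_cvgy.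
rewrite sub0e -EFinN => <-; last first.
- by move=> x _; rewrite Fder.
- by apply: cvg_at_right_filter; exact: Fcont.
- by move=> x _; case: (dF x).
rewrite -ge0_integralZl//; last 3 first.
- by apply/measurable_EFinP/measurable_funTS.
- by move=> x _; rewrite lee_fin pdf_ge0.
- by rewrite lee_fin sqr_ge0.
rewrite -ge0_integralD//=.
- by apply: eq_integral => x _; rewrite -EFinM -EFinD; congr EFin; ring.
- by move=> x; rewrite in_itv/= andbT => sx; rewrite lee_fin f0.
- apply/measurable_EFinP/measurable_funTS.
  by apply: measurable_funM => //; exact: measurable_funB.
- by move=> x _; rewrite -EFinM lee_fin mulr_ge0 ?sqr_ge0 ?pdf_ge0.
- apply/measurable_EFinP/measurable_funTS.
  exact: measurable_funM.
Qed.

Let bulk : (\int[mu]_(x in `[0%R, sd[) (x ^+ 2 * pdf x)%:E + (- F sd)%:E =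
  (sd ^+ 2)%:E * \int[mu]_(x in `[0%R, sd[) (pdf x)%:E)%E.
Proof.
have f0 x : 0 <= x <= sd -> 0 <= (sd ^+ 2 - x ^+ 2) * pdf x.
  move=> /andP[x0 sx]; rewrite mulr_ge0 ?pdf_ge0// subr_ge0.
  by rewrite ler_pXn2r ?nnegrE// ltW.
have -> : ((- F sd)%:E = \int[mu]_(x in `[0%R, sd[) ((sd ^+ 2 - x ^+ 2) * pdf x)%:E)%E.
  rewrite integral_itv_bndo_bndc; last first.
    apply/measurable_EFinP/measurable_funTS.
    by apply: measurable_funM => //; exact: measurable_funB.
  rewrite (@continuous_FTC2 _ _ (fun x => - F x))//.
  - by rewrite -EFinB; congr EFin; rewrite /F; ring.
  - apply: continuous_subspaceT => x; apply: cvgM; last exact: pdf_continuous.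
    by apply: cvgB; [exact: cvg_cst|exact: exprn_continuous].
  - split=> [x _||].
    + by apply: derivableN; case: (dF x).
    + by apply: cvgN; apply: cvg_at_right_filter; exact: Fcont.
    + by apply: cvgN; apply: cvg_at_left_filter; exact: Fcont.
  - move=> x _; rewrite derive1E deriveN; last by case: (dF x).
    by rewrite -derive1E Fder; ring.
rewrite -ge0_integralZl//; last 3 first.
- by apply/measurable_EFinP/measurable_funTS.
- by move=> x _; rewrite lee_fin pdf_ge0.
- by rewrite lee_fin sqr_ge0.
rewrite -ge0_integralD//=.
- by apply: eq_integral => x _; rewrite -EFinM -EFinD; congr EFin; ring.
- exact: measurable_funTS.
- move=> x; rewrite in_itv/= => /andP[x0 xs]; rewrite lee_fin f0// x0.
  exact: ltW.
- apply/measurable_EFinP/measurable_funTS.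
  by apply: measurable_funM => //; exact: measurable_funB.
Qed.

Lemma normal_second_moment : (\int[nu]_x (x ^+ 2)%:E = (sd ^+ 2)%:E)%E.
Proof.
rewrite integral_normal_prob; last 2 first.
- by move=> x; rewrite lee_fin sqr_ge0.
- by apply/measurable_EFinP; exact: measurable_funX.
under eq_integral do rewrite -EFinM.
rewrite (ge0_symfun_integralT (f := fun x => x ^+ 2 * pdf x)); last 3 first.
- by move=> x; rewrite -lee_fin.
- by move=> x; apply: cvgM; [exact: exprn_continuous|exact: pdf_continuous].
- by move=> x /=; rewrite sqrrN pdf_even.
have half (h : R -> R) : (forall x, 0 <= h x) -> measurable_fun setT h ->
  (\int[mu]_(x in [set x | (0 <= x)%R]) (h x)%:E =
   \int[mu]_(x in `[0%R, sd[) (h x)%:E + \int[mu]_(x in `[sd, +oo[) (h x)%:E)%E.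
  move=> h0 mh; rewrite -ge0_integral_setU//=.
  - congr (integral _ _ _); apply/seteqP; split=> [x /= x0|x /=].
      rewrite !in_itv/= x0/= andbT; have [|] := ltP x sd; first by left.
      by right.
    by rewrite !in_itv/= andbT => -[/andP[]//|]; apply: le_trans; exact: ltW.
  - by apply/measurable_EFinP/measurable_funTS.
  - by move=> x _; rewrite lee_fin.
  - apply/disj_setPS => x [/=]; rewrite !in_itv/= andbT => /andP[_ xs] sx.
    by move: (lt_le_trans xs sx); rewrite ltxx.
have x2pdf0 x : 0 <= x ^+ 2 * pdf x by rewrite -lee_fin.
rewrite half//; last by apply/measurable_EFinP.
have := integral_normal_pdf (0 : R) sd.
rewrite (ge0_symfun_integralT (f := pdf)); last 3 first.
- exact: pdf_ge0.
- exact: pdf_continuous.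
- by move=> x /=; rewrite pdf_even.
rewrite half//; last exact: pdf_ge0.
have fin (D : set R) : measurable D -> (\int[mu]_(x in D) (pdf x)%:E)%E \is a fin_num.
  move=> mD; apply: integrable_fin_num => //.
  by apply: (integrableS _ _ (subsetT _)) => //; exact: integrable_normal_pdf.
move: tail bulk; rewrite -(fineK (fin `[0%R, sd[%classic _))//.
rewrite -(fineK (fin `[sd, +oo[%classic _))//.
set a := fine _; set b := fine _ => -> .
rewrite -!EFinM -!EFinD.
case: (\int[mu]_(x in `[0%R, sd[) _)%E => [r| |]//= [rE] [ab1].
rewrite -!EFinD -!EFinM; congr EFin.
have -> : r = sd ^+ 2 * b + F sd by lra.
transitivity (sd ^+ 2 * (2 * (b + a))); first by ring.
by rewrite ab1 mulr1.
Qed.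

(** The form in which the mean of the law vanishes without its integrability
    being known: both sides are integrals of nonnegative functions. *)
Lemma normal_symmetric :
  (\int[nu]_x (`|x| + x)%:E = \int[nu]_x (`|x| - x)%:E)%E.
Proof.
have p0 (x : R) : 0 <= `|x| + x by have := ler_norm (- x); rewrite normrN; lra.
have n0 (x : R) : 0 <= `|x| - x by have := ler_norm x; lra.
have mn : measurable_fun [set: R] (fun x : R => `|x|) by exact: normr_measurable.
have mD : measurable_fun [set: R] (fun x : R => `|x| + x) by exact: measurable_funD.
have mB : measurable_fun [set: R] (fun x : R => `|x| - x) by exact: measurable_funB.
rewrite !integral_normal_prob; [|by move=> x; rewrite lee_fin|by apply/measurable_EFinP
  |by move=> x; rewrite lee_fin|by apply/measurable_EFinP].
have split (h : R -> R) : (forall x, 0 <= h x) -> measurable_fun setT h ->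
  (\int[mu]_x ((h x)%:E * (pdf x)%:E) =
   \int[mu]_(x in `]-oo, 0%R]) (h x * pdf x)%:E +
   \int[mu]_(x in `[0%R, +oo[) (h x * pdf x)%:E)%E.
  move=> h0 mh; have mhp : measurable_fun setT (fun x => (h x * pdf x)%:E).
    by apply/measurable_EFinP; exact: measurable_funM.
  rewrite -integral_itv_obnd_cbnd; last exact: measurable_funTS.
  rewrite -ge0_integral_setU//=.
  - rewrite (_ : _ `|` _ = setT)//; apply/seteqP; split=> // x _ /=.
    by rewrite !in_itv/= andbT; have [|] := leP x 0; [left|right].
  - exact: measurable_funTS.
  - by move=> x _; rewrite lee_fin mulr_ge0 ?pdf_ge0.
  - apply/disj_setPS => x [/=]; rewrite !in_itv/= andbT => x0 x0'.
    by move: (lt_le_trans x0' x0); rewrite ltxx.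
rewrite !split//.
rewrite [X in (X + _)%E = _]integral0_eq; last first.
  by move=> x /=; rewrite in_itv/= => x0; rewrite ler0_norm// addNr mul0r.
rewrite [X in _ = (_ + X)%E]integral0_eq; last first.
  by move=> x /=; rewrite in_itv/= andbT => x0; rewrite ger0_norm// subrr mul0r.
rewrite add0e adde0 -{2}oppr0 ge0_integration_by_substitutionNy.
- by apply: eq_integral => x _ /=; rewrite normrN opprK pdf_even.
- apply: continuous_subspaceT => x; apply: cvgM; last exact: pdf_continuous.
  by apply: cvgB => //; exact: norm_continuous.
- by move=> x _; rewrite mulr_ge0 ?pdf_ge0.
Qed.

End normal_moments.

(** * Brownian and Poisson increments *)

Section laws.
Context d (T : measurableType d) (R : realType) (P : probability T R).

Lemma law_integral (V : T -> R) (nu : probability (measurableTypeR R) R)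
    (g : R -> \bar R) :
  measurable_fun setT V ->
  (forall A : set R, measurable A -> P (V @^-1` A) = nu A) ->
  (forall x, (0 <= g x)%E) -> measurable_fun setT g ->
  (\int[P]_w g (V w) = \int[nu]_x g x)%E.
Proof.
move=> mV lV g0 mg.
pose F : {mfun T >-> measurableTypeR R} :=
  HB.pack V (isMeasurableFun.Build _ _ T (measurableTypeR R) V mV).
transitivity (\int[distribution P F]_x g x)%E.
  by rewrite ge0_integral_pushforward.
by apply: eq_measure_integral => A mA _; exact: lV.
Qed.

Lemma normal_law_moments (V : T -> R) (sd : R) : 0 < sd ->
  measurable_fun setT V ->
  (forall A : set R, measurable A -> P (V @^-1` A) = normal_prob 0 sd A) ->
  [/\ L2 P V, Ex P V = 0 & Ex P (fun w => V w ^+ 2) = sd ^+ 2].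
Proof.
move=> sd0 mV lV.
have sq : (\int[P]_w (V w ^+ 2)%:E = (sd ^+ 2)%:E)%E.
  rewrite -(normal_second_moment sd0).
  apply: (@law_integral V (normal_prob 0 sd) (fun x => (x ^+ 2)%:E)) => //.
    by move=> x; rewrite lee_fin sqr_ge0.
  by apply/measurable_EFinP; exact: measurable_funX.
have L2V : L2 P V.
  split=> //; apply/integrableP; split.
    by apply/measurable_EFinP; exact: measurable_funX.
  rewrite (eq_integral (fun w => (V w ^+ 2)%:E)).
    by rewrite sq ltry.
  by move=> w _; rewrite gee0_abs// lee_fin sqr_ge0.
split=> //; last by rewrite /Ex /Rintegral sq.
have L1V := L2_L1 L2V.
have LaV : L1 P (fun w => `|V w|).
  apply: (L1_le _ L1V) => [|w]; last by rewrite normr_id.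
  exact: measurableT_comp.
have p0 (x : R) : 0 <= `|x| + x by have := ler_norm (- x); rewrite normrN; lra.
have n0 (x : R) : 0 <= `|x| - x by have := ler_norm x; lra.
have mn : measurable_fun [set: R] (fun x : R => `|x|) by exact: normr_measurable.
have : Ex P (fun w => `|V w| + V w) = Ex P (fun w => `|V w| - V w).
  rewrite /Ex /Rintegral; congr fine.
  rewrite (@law_integral V (normal_prob 0 sd) (fun x => (`|x| + x)%:E))//; last first.
    by apply/measurable_EFinP; exact: measurable_funD.
  rewrite (@law_integral V (normal_prob 0 sd) (fun x => (`|x| - x)%:E))//; last first.
    by apply/measurable_EFinP; exact: measurable_funB.
  exact: normal_symmetric.
rewrite ExD// ExB//; lra.
Qed.

Section brownian.
Variable W : R -> {RV P >-> R}.
Hypothesis BW : brownian_motion W.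

Lemma brownian_increment u v : 0 <= u -> u <= v ->
  [/\ L2 P (fun w => W v w - W u w), Ex P (fun w => W v w - W u w) = 0
    & Ex P (fun w => (W v w - W u w) ^+ 2) = v - u].
Proof.
move=> u0; rewrite le_eqVlt => /predU1P[<-|uv].
  rewrite subrr; under [X in L2 P X]eq_fun do rewrite subrr.
  under [X in Ex P X]eq_fun do rewrite subrr.
  split; [exact: L2_cst|exact: (Ex_cst P 0)|].
  by under [X in Ex P X]eq_fun do rewrite subrr expr0n; exact: (Ex_cst P 0).
have [_ _ law] := BW.
have sd0 : 0 < Num.sqrt (v - u) by rewrite sqrtr_gt0 subr_gt0.
have uv' : 0 <= u < v by rewrite u0.
have mV : measurable_fun setT (fun w => W v w - W u w) by exact: measurable_funB.
have := normal_law_moments sd0 mV (law u v uv').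
by rewrite sqr_sqrtr// subr_ge0 ltW.
Qed.

(** Polarisation: with x, y, z the increments over [a, b], [b, c] and [c, e],
    the variances of x + y, y + z and x + y + z determine E(x z), since the
    variance of an increment is the length of its interval. *)
Lemma brownian_increment_orth a b c e : 0 <= a -> a <= b -> b <= c -> c <= e ->
  Ex P (fun w => (W b w - W a w) * (W e w - W c w)) = 0.
Proof.
move=> a0 ab bc ce.
have b0 := le_trans a0 ab; have c0 := le_trans b0 bc.
have [Lx _ x2] := brownian_increment a0 ab.
have [Ly _ y2] := brownian_increment b0 bc.
have [Lz _ z2] := brownian_increment c0 ce.
have [_ _ xy2] := brownian_increment a0 (le_trans ab bc).
have [_ _ yz2] := brownian_increment b0 (le_trans bc ce).
have [_ _ xyz2] := brownian_increment a0 (le_trans ab (le_trans bc ce)).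
set x := (fun w => W b w - W a w) in Lx x2 *.
set y := (fun w => W c w - W b w) in Ly y2 *.
set z := (fun w => W e w - W c w) in Lz z2 *.
have pol (f g : T -> R) : L2 P f -> L2 P g ->
    Ex P (fun w => (f w + g w) ^+ 2) = Ex P (fun w => f w ^+ 2) +
      2 * Ex P (fun w => f w * g w) + Ex P (fun w => g w ^+ 2).
  move=> Lf Lg; rewrite -ExZ; last exact: L2M.
  rewrite -ExD; [|by case: Lf|by apply: L1Z; exact: L2M].
  rewrite -ExD; [|by apply: L1D; [case: Lf|apply: L1Z; exact: L2M]|by case: Lg].
  by congr Ex; apply/funext => w; ring.
have := pol _ _ Lx Ly; have := pol _ _ Ly Lz; have := pol _ _ (L2D Lx Ly) Lz.
have -> : (fun w => (x w + y w + z w) ^+ 2) = (fun w => (W e w - W a w) ^+ 2).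
  by apply/funext => w; rewrite /x /y /z; ring.
have -> : (fun w => (y w + z w) ^+ 2) = (fun w => (W e w - W b w) ^+ 2).
  by apply/funext => w; rewrite /y /z; ring.
have -> : (fun w => (x w + y w) ^+ 2) = (fun w => (W c w - W a w) ^+ 2).
  by apply/funext => w; rewrite /x /y; ring.
have -> : Ex P (fun w => (x w + y w) * z w) =
    Ex P (fun w => x w * z w) + Ex P (fun w => y w * z w).
  rewrite -ExD; [|exact: L2M|exact: L2M].
  by congr Ex; apply/funext => w; ring.
rewrite x2 y2 z2 xy2 yz2 xyz2; lra.
Qed.

End brownian.

Lemma exp_coeff_series (c x : R) :
  (\sum_(0 <= k < n) (c * exp_coeff x k)%:E)%E @[n --> \oo] --> (c * expR x)%:E.
Proof.
under eq_fun do rewrite sumEFin -mulr_sumr.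
apply: cvg_EFin; first by near=> n.
apply: cvgMr; exact: is_cvg_series_exp_coeff.
Unshelve. all: by end_near. Qed.

Section poisson.
Variables (rate : R) (N : R -> {RV P >-> R}).
Hypothesis rate0 : 0 < rate.
Hypothesis PN : poisson_process rate N.
Variables u v : R.
Hypothesis u0 : 0 <= u.
Hypothesis uv : u < v.
Let lam := rate * (v - u).
Let A (k : nat) := [set w | N v w - N u w = k%:R].

Let lam0 : 0 < lam. Proof. by rewrite mulr_gt0// subr_gt0. Qed.

Let mNuv : measurable_fun setT (fun w => N v w - N u w).
Proof. exact: measurable_funB. Qed.

Let mA k : measurable (A k).
Proof.
rewrite [A k](_ : _ = setT `&` (fun w => N v w - N u w) @^-1` [set k%:R]).
  exact: mNuv.
by rewrite setTI.
Qed.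

Let PA k : P (A k) = (lam ^+ k * k`!%:R^-1 * expR (- lam))%:E.
Proof.
have [_ _ ->] := PN; last by rewrite u0.
by rewrite /poisson_pmf -/lam lam0.
Qed.

Let trivA : trivIset setT A.
Proof.
by move=> i j _ _ [w []]; rewrite /A /= => -> /eqP; rewrite eqr_nat => /eqP.
Qed.

Let UA := \bigcup_k A k.

Let mUA : measurable UA. Proof. exact: bigcup_measurable. Qed.

Let PUA : P (~` UA) = 0%E.
Proof.
rewrite probability_setC// /UA measure_bigcup//=.
have -> : (\sum_(0 <= i <oo | i \in [set: nat]) P (A i) = 1)%E.
  apply: cvg_lim => //.
  have := @exp_coeff_series (expR (- lam)) lam.
  rewrite -expRD addNr expR0; apply: cvg_trans; apply: near_eq_cvg; near=> n.
  rewrite [in RHS]big_mkcond; apply: eq_bigr => k _.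
  by rewrite in_setT PA /exp_coeff/=; congr EFin; ring.
by rewrite subee.
Unshelve. all: by end_near. Qed.

(** E (-1)^K = exp(-2 lam) for a Poisson variable K of parameter lam. Adding 1
    makes the integrand nonnegative, so that its integral may be summed over the
    values of K; the two exponential series in lam and - lam appear. *)
Lemma Ex_flip : Ex P (fun w => flip (fun r => N r w) u v) = expR (- (2 * lam)).
Proof.
have mf : measurable_fun setT (fun w => flip (fun r => N r w) u v).
  apply: measurableT_comp; first exact: continuous_measurable_fun (@continuous_cos R).
  exact: measurable_funM.
have f1 w : -1 <= flip (fun r => N r w) u v <= 1.
  by rewrite /flip cos_geN1 cos_le1.
have bf : bounded_rv (fun w => flip (fun r => N r w) u v).
  by split=> //; exists 1 => w; rewrite ler_norml.
have Lf := bd_L1 P bf.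
suff : Ex P (fun w => 1 + flip (fun r => N r w) u v) = 1 + expR (- (2 * lam)).
  by rewrite ExD//; [rewrite (Ex_cst P 1); lra|exact: L1_cst].
have g0 w : (0 <= (1 + flip (fun r => N r w) u v)%:E)%E.
  by rewrite lee_fin; have := f1 w; lra.
have mg : measurable_fun setT (fun w => (1 + flip (fun r => N r w) u v)%:E).
  by apply/measurable_EFinP; exact: measurable_funD.
rewrite /Ex /Rintegral -(setvU UA) ge0_integral_setU//; last 3 first.
- exact: measurableC.
- by rewrite setvU.
- by apply/disj_setPS => w [].
rewrite null_set_integral//; last 2 first.
- exact: measurableC.
- exact: measurable_funTS.
rewrite add0e ge0_integral_bigcup//; last exact: measurable_funTS.
have intA k : (\int[P]_(w in A k) (1 + flip (fun r => N r w) u v)%:E =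
    ((1 + (-1) ^+ k) * (lam ^+ k * k`!%:R^-1 * expR (- lam)))%:E)%E.
  rewrite (eq_integral (cst (1 + (-1) ^+ k)%:E)); last first.
    by move=> w; rewrite inE /flip /A /= => ->; rewrite cos_pi_nat.
  by rewrite integral_cst// EFinM; congr (_ * _)%E; exact: PA.
rewrite (eq_eseriesr (fun k _ => intA k)).
rewrite (_ : limn _ = (1 + expR (- (2 * lam)))%:E)//.
apply: cvg_lim => //.
have := cvgeD _ (@exp_coeff_series (expR (- lam)) lam) (@exp_coeff_series (expR (- lam)) (- lam)).
rewrite -EFinD -!expRD addNr expR0 (_ : - lam - lam = - (2 * lam)); last by ring.
move=> /(_ _ isT); apply: cvg_trans; apply: near_eq_cvg; near=> n.
rewrite -big_split/=; apply: eq_bigr => k _; rewrite -EFinD; congr EFin.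
by rewrite /exp_coeff/= (exprNn lam); ring.
Unshelve. all: by end_near. Qed.

(** 1 - exp(-lam) (1 + lam) is at most lam^2 because exp(-lam) >= 1 - lam. *)
Lemma poisson_two_jumps :
  (P [set w | ~ (N v w - N u w = 0 \/ N v w - N u w = 1)%R] <= (lam ^+ 2)%:E)%E.
Proof.
have -> : [set w | ~ (N v w - N u w = 0 \/ N v w - N u w = 1)%R] = ~` (A 0%N `|` A 1%N).
  by [].
rewrite probability_setC; last exact: measurableU.
rewrite measureU//; last first.
  by apply/seteqP; split=> // w []; rewrite /A /= => -> /eqP; rewrite eqr_nat.
rewrite [X in (1 - X <= _)%E](_ : _ = (expR (- lam) + lam * expR (- lam))%:E); last first.
  rewrite EFinD; congr (_ + _)%E; rewrite [LHS]PA; congr EFin.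
    by rewrite expr0 fact0 invr1 !mul1r.
  by rewrite expr1 invr1 mulr1.
rewrite -EFinB lee_fin.
have := expR_ge1Dx (- lam); have := lam0; nra.
Qed.

End poisson.
End laws.

(** * Brownian increments weighted by functions of the Poisson path *)

Section noise.
Context d (T : measurableType d) (R : realType) (P : probability T R).

(** A generating class of [sigma_process Z], named so that [g_sigma_algebraType]
    turns measurability for that sigma-algebra into an instance of
    [measurable_fun]. *)
Definition proc_gen (Z : R -> T -> R) : set (set T) :=
  \bigcup_(t in `[0, +oo[) sigma_rv (Z t).

Definition proc_measurable (Z : R -> T -> R) (f : T -> R) :=
  measurable_fun setT (f : g_sigma_algebraType (proc_gen Z) -> R).

Lemma proc_measurable_sigma Z f (B : set R) : proc_measurable Z f -> measurable B ->
  sigma_process Z (f @^-1` B).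
Proof. by move=> mf mB; rewrite -[X in sigma_process Z X]setTI; exact: mf. Qed.

Lemma proc_measurable_at (Z : R -> T -> R) t : 0 <= t -> proc_measurable Z (Z t).
Proof.
move=> t0 _ B mB; apply: sub_sigma_algebra; exists t.
  by rewrite /= in_itv/= t0.
by exists B.
Qed.

Variables W1 W2 N : R -> {RV P >-> R}.
Hypothesis BW1 : brownian_motion W1.
Hypothesis BW2 : brownian_motion W2.
Hypothesis ind : independent_processes P
  (tnth [tuple (W1 : R -> T -> R); (W2 : R -> T -> R); (N : R -> T -> R)]).

Lemma independent_triple (F G H : T -> R) :
  proc_measurable N F -> proc_measurable W1 G -> proc_measurable W2 H ->
  indep3 P F G H.
Proof.
move=> mF mG mH A B C mA mB mC.
pose E (i : 'I_3) : set T := tnth [tuple G @^-1` B; H @^-1` C; F @^-1` A] i.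
have := ind (E := E); rewrite /independent_sigma.
have -> : \bigcap_(i : 'I_3) E i = F @^-1` A `&` (G @^-1` B `&` H @^-1` C).
  apply/seteqP; split=> [w Ew|w [wA [wB wC]]].
    split; first exact: (Ew (@Ordinal 3 2 isT) I).
    by split; [exact: (Ew (@Ordinal 3 0 isT) I)|exact: (Ew (@Ordinal 3 1 isT) I)].
  by move=> i _; case: i => [[|[|[|]]]].
rewrite !big_ord_recl big_ord0 => -> //; last first.
  by case=> [[|[|[|]]]] // il; exact: proc_measurable_sigma.
by rewrite /E/=; rewrite mule1 muleA muleC.
Qed.

(** Functions of the whole Poisson path, the future included: the coefficients
    (-1)^(N_t - N_u) of the scheme anticipate, and the isometry rests on the
    independence of N from the Brownian motions. *)
Definition integrand (f : T -> R) := bounded_rv f /\ proc_measurable N f.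

Lemma integrandM f g : integrand f -> integrand g -> integrand (fun w => f w * g w).
Proof. by move=> [bf mf] [bg mg]; split; [exact: bdM|exact: measurable_funM]. Qed.

Lemma integrandB f g : integrand f -> integrand g -> integrand (fun w => f w - g w).
Proof. by move=> [bf mf] [bg mg]; split; [exact: bdB|exact: measurable_funB]. Qed.

Lemma integrandD f g : integrand f -> integrand g -> integrand (fun w => f w + g w).
Proof. by move=> [bf mf] [bg mg]; split; [exact: bdD|exact: measurable_funD]. Qed.

Lemma integrand_cst c : integrand (cst c).
Proof. by split; [exact: bd_cst|exact: measurable_cst]. Qed.

Lemma integrand_sum n (F : 'I_n -> T -> R) : (forall i, integrand (F i)) ->
  integrand (fun w => \sum_(i < n) F i w).
Proof.
elim: n F => [|n IH] F FL.
  by under [X in integrand X]eq_fun do rewrite big_ord0; exact: integrand_cst.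
under [X in integrand X]eq_fun do rewrite big_ord_recr/=.
by apply: integrandD => //; exact: IH.
Qed.

Lemma integrand_flip u v : 0 <= u -> 0 <= v ->
  integrand (fun w => flip (fun r => N r w) u v).
Proof.
move=> u0 v0; have mcos : measurable_fun setT (@cos R).
  exact: continuous_measurable_fun (@continuous_cos R).
split; last first.
  apply: (measurableT_comp mcos); apply: measurable_funM => //.
  by apply: measurable_funB; exact: proc_measurable_at.
split.
  by apply: (measurableT_comp mcos); apply: measurable_funM => //; exact: measurable_funB.
by exists 1 => w; rewrite ler_norml cos_geN1 cos_le1.
Qed.

Lemma Ex_factor1 (F G : T -> R) : integrand F -> proc_measurable W1 G -> L1 P G ->
  Ex P (fun w => F w * G w) = Ex P F * Ex P G.
Proof.
move=> [bF mF] mG LG; apply: indep2_Ex => //; first exact: bd_L1.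
move=> A B mA mB; have := independent_triple mF mG (@measurable_cst _ _ _ _ _ (0 : R))
  mA mB measurableT.
by rewrite preimage_setT setIT probability_setT mule1.
Qed.

Lemma Ex_factor2 (F H : T -> R) : integrand F -> proc_measurable W2 H -> L1 P H ->
  Ex P (fun w => F w * H w) = Ex P F * Ex P H.
Proof.
move=> [bF mF] mH LH; apply: indep2_Ex => //; first exact: bd_L1.
move=> A B mA mB; have := independent_triple mF (@measurable_cst _ _ _ _ _ (0 : R)) mH
  mA measurableT mB.
by rewrite preimage_setT setTI probability_setT mul1e.
Qed.

(** Independence of three variables gives the product rule in two steps: G and H
    are independent, and F is independent of the pair (G, H). *)
Lemma Ex_factor12 (F G H : T -> R) : integrand F ->
  proc_measurable W1 G -> L1 P G -> proc_measurable W2 H -> L1 P H ->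
  measurable_fun setT G -> measurable_fun setT H ->
  Ex P (fun w => F w * (G w * H w)) = Ex P F * (Ex P G * Ex P H).
Proof.
move=> [bF mF] mG LG mH LH mG' mH'.
have fgh := independent_triple mF mG mH.
have gh := indep3_indep2 fgh.
rewrite -indep2_Ex// -indep2_Ex//; first exact: bd_L1; first exact: indep2_L1.
have mul_meas : measurable_fun setT (fun z : R * R => z.1 * z.2).
  by apply: measurable_funM; [exact: measurable_fst|exact: measurable_snd].
have := indep3_pair _ mG' mH' fgh; move=> /(_ bF.1) fp.
exact: (indep2_comp (@measurable_id _ _ setT) mul_meas fp).
Qed.

Section increments.
Variables (t : R) (j : nat).
Hypothesis t0 : 0 <= t.
Let g := grid t j.
Let n := (2 ^ j)%N.
Let h := t / n%:R.
Let dW (W : R -> {RV P >-> R}) k w := W (g k.+1) w - W (g k) w.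

Let g0 k : 0 <= g k. Proof. by rewrite -(grid0 t j); exact: grid_homo. Qed.
Let gle k l : (k <= l)%N -> g k <= g l. Proof. exact: grid_homo. Qed.

Let dW_moments W k : brownian_motion W ->
  [/\ L2 P (dW W k), Ex P (dW W k) = 0 & Ex P (fun w => dW W k w ^+ 2) = h].
Proof. by move=> BW; have := brownian_increment BW (g0 k) (gle (leqnSn k)); rewrite gridS. Qed.

Let dW_orth W k l : brownian_motion W ->
  Ex P (fun w => dW W k w * dW W l w) = if k == l then h else 0.
Proof.
move=> BW; have [kl|lk|->] := ltngtP k l.
- by apply: brownian_increment_orth => //; apply: gle.
- under [X in Ex P X]eq_fun do rewrite mulrC.
  by apply: brownian_increment_orth => //; apply: gle.
- by have [_ _ <-] := dW_moments l BW.
Qed.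

Let dW_proc (W : R -> {RV P >-> R}) k : proc_measurable W (dW W k).
Proof. by apply: measurable_funB; exact: proc_measurable_at. Qed.

Definition noise (a1 a2 : R) k w := a1 * dW W1 k w + a2 * dW W2 k w.

Lemma noise_L2 a1 a2 k : L2 P (noise a1 a2 k).
Proof.
by apply: L2D; apply: L2Z; [have [] := dW_moments k BW1|have [] := dW_moments k BW2].
Qed.

Lemma noise_mean F a1 a2 k : integrand F -> Ex P (fun w => F w * noise a1 a2 k w) = 0.
Proof.
move=> iF; have [L1k m1 _] := dW_moments k BW1; have [L2k m2 _] := dW_moments k BW2.
have LF1 := L1_bdM iF.1 (L2_L1 L1k); have LF2 := L1_bdM iF.1 (L2_L1 L2k).
have -> : (fun w => F w * noise a1 a2 k w) =
    (fun w => a1 * (F w * dW W1 k w) + a2 * (F w * dW W2 k w)).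
  by apply/funext => w; rewrite /noise; ring.
rewrite ExD; [|exact: L1Z|exact: L1Z]; rewrite !ExZ//.
rewrite Ex_factor1//; last exact: L2_L1.
rewrite Ex_factor2//; last exact: L2_L1.
by rewrite m1 m2 !mulr0 addr0.
Qed.

Lemma noise_orth F a1 a2 b1 b2 k l : integrand F ->
  Ex P (fun w => F w * (noise a1 a2 k w * noise b1 b2 l w)) =
  Ex P F * (if k == l then (a1 * b1 + a2 * b2) * h else 0).
Proof.
move=> iF.
have [L1k m1k _] := dW_moments k BW1; have [L2k m2k _] := dW_moments k BW2.
have [L1l m1l _] := dW_moments l BW1; have [L2l m2l _] := dW_moments l BW2.
have LF f : L1 P f -> L1 P (fun w => F w * f w) by exact: L1_bdM iF.1.
have -> : (fun w => F w * (noise a1 a2 k w * noise b1 b2 l w)) =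
    (fun w => (a1 * b1) * (F w * (dW W1 k w * dW W1 l w)) +
      ((a2 * b2) * (F w * (dW W2 k w * dW W2 l w)) +
       ((a1 * b2) * (F w * (dW W1 k w * dW W2 l w)) +
        (a2 * b1) * (F w * (dW W1 l w * dW W2 k w))))).
  by apply/funext => w; rewrite /noise; ring.
have LL f f' : L2 P f -> L2 P f' -> L1 P (fun w => F w * (f w * f' w)).
  by move=> Lf Lf'; apply: LF; exact: L2M.
have LZ c f f' : L2 P f -> L2 P f' -> L1 P (fun w => c * (F w * (f w * f' w))).
  by move=> Lf Lf'; apply: L1Z; exact: LL.
rewrite ExD; [|exact: LZ|apply: L1D; [exact: LZ|apply: L1D; exact: LZ]].
rewrite ExD; [|exact: LZ|apply: L1D; exact: LZ].
rewrite ExD; [|exact: LZ|exact: LZ].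
rewrite !ExZ; [|exact: LL|exact: LL|exact: LL|exact: LL].
have mm f : L2 P f -> measurable_fun setT f by exact: L2_measurable.
rewrite (Ex_factor1 iF (G := fun w => dW W1 k w * dW W1 l w)); last 2 first.
- by apply: measurable_funM; exact: dW_proc.
- exact: L2M.
rewrite (Ex_factor2 iF (H := fun w => dW W2 k w * dW W2 l w)); last 2 first.
- by apply: measurable_funM; exact: dW_proc.
- exact: L2M.
rewrite (Ex_factor12 iF (dW_proc (W:=W1) k) (L2_L1 L1k) (dW_proc (W:=W2) l) (L2_L1 L2l))//;
  [|exact: mm|exact: mm].
rewrite (Ex_factor12 iF (dW_proc (W:=W1) l) (L2_L1 L1l) (dW_proc (W:=W2) k) (L2_L1 L2k))//;
  [|exact: mm|exact: mm].
rewrite m1k m1l !mul0r !mulr0 !addr0 !dW_orth//.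
by case: ifP => _; ring.
Qed.

Definition noise_sum a1 a2 (a : nat -> T -> R) w :=
  \sum_(k < n) a k w * noise a1 a2 k w.

Lemma noise_sum_L2 a1 a2 a : (forall k, integrand (a k)) -> L2 P (noise_sum a1 a2 a).
Proof. by move=> ia; apply: L2_sum => k; apply: L2_bdM; [case: (ia k)|exact: noise_L2]. Qed.

Lemma noise_sum_mean F a1 a2 a : integrand F -> (forall k, integrand (a k)) ->
  Ex P (fun w => F w * noise_sum a1 a2 a w) = 0.
Proof.
move=> iF ia.
have -> : (fun w => F w * noise_sum a1 a2 a w) =
    (fun w => \sum_(k < n) (F w * a k w) * noise a1 a2 k w).
  by apply/funext => w; rewrite mulr_sumr; apply: eq_bigr => k _; rewrite mulrA.
rewrite Ex_sum.
  by rewrite big1// => k _; apply: noise_mean; exact: integrandM.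
by move=> k; apply: L1_bdM; [apply: bdM; [case: iF|case: (ia k)]|apply/L2_L1/noise_L2].
Qed.

(** The discrete Ito isometry: distinct cells are orthogonal, and each cell has
    covariance (a1 b1 + a2 b2) h. *)
Lemma noise_isometry a1 a2 b1 b2 a b :
  (forall k, integrand (a k)) -> (forall k, integrand (b k)) ->
  Ex P (fun w => noise_sum a1 a2 a w * noise_sum b1 b2 b w) =
  (a1 * b1 + a2 * b2) * h * \sum_(k < n) Ex P (fun w => a k w * b k w).
Proof.
move=> ia ib.
have -> : (fun w => noise_sum a1 a2 a w * noise_sum b1 b2 b w) =
    (fun w => \sum_(k < n) \sum_(l < n)
       (a k w * b l w) * (noise a1 a2 k w * noise b1 b2 l w)).
  apply/funext => w; rewrite mulr_suml; apply: eq_bigr => k _.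
  by rewrite mulr_sumr; apply: eq_bigr => l _; ring.
have Lkl k l : L1 P (fun w => (a k w * b l w) * (noise a1 a2 k w * noise b1 b2 l w)).
  apply: L1_bdM; first by apply: bdM; [case: (ia k)|case: (ib l)].
  by apply: L2M; exact: noise_L2.
rewrite Ex_sum; last by move=> k; apply: L1_sum => l; exact: Lkl.
rewrite mulr_sumr; apply: eq_bigr => k _.
rewrite Ex_sum; last by move=> l; exact: Lkl.
rewrite (bigD1 k)//= big1 ?addr0.
  by rewrite noise_orth; [rewrite eqxx mulrC|exact: integrandM].
move=> l lk; rewrite noise_orth; last exact: integrandM.
by rewrite ifF ?mulr0//; apply/negbTE; rewrite eq_sym; exact: lk.
Qed.

End increments.
End noise.

(** * Almost sure limits of L2-Cauchy sequences *)

Section L2_limit.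
Context d (T : measurableType d) (R : realType) (P : probability T R).

(** A weighted arithmetic-geometric inequality; optimising K would give
    Cauchy-Schwarz. *)
Lemma Ex_mul_bound (K : R) (f Q : T -> R) : 0 < K -> L2 P f -> L2 P Q ->
  `|Ex P (fun w => f w * Q w)| <=
    K / 2 * Ex P (fun w => f w ^+ 2) + (2 * K)^-1 * Ex P (fun w => Q w ^+ 2).
Proof.
move=> K0 Lf LQ; have [_ f2] := Lf; have [_ Q2] := LQ.
rewrite -ExZ// -ExZ// -ExD; [|exact: L1Z|exact: L1Z].
have LfQ := L2M Lf LQ.
have Lb : L1 P (fun w => K / 2 * f w ^+ 2 + (2 * K)^-1 * Q w ^+ 2).
  by apply: L1D; exact: L1Z.
have am w : `|f w * Q w| <= K / 2 * f w ^+ 2 + (2 * K)^-1 * Q w ^+ 2.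
  rewrite -subr_ge0 normrM -(real_normK (num_real (f w))) -(real_normK (num_real (Q w))).
  have -> : K / 2 * `|f w| ^+ 2 + (2 * K)^-1 * `|Q w| ^+ 2 - `|f w| * `|Q w| =
      (2 * K)^-1 * (K * `|f w| - `|Q w|) ^+ 2.
    by field; rewrite gt_eqF.
  by rewrite mulr_ge0 ?sqr_ge0// invr_ge0 mulr_ge0// ltW.
rewrite ler_norml; apply/andP; split.
  rewrite lerNl -mulN1r -ExZ//; apply: Ex_le => //; first exact: L1Z.
  by move=> w; rewrite mulN1r (le_trans _ (am w))// -normrN ler_norm.
by apply: Ex_le => // w; rewrite (le_trans _ (am w))// ler_norm.
Qed.

Variables (S : nat -> T -> R) (D : T -> R) (eps : nat -> R).
Hypothesis LS : forall i, L2 P (S i).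
Hypothesis mD : measurable_fun setT D.
Hypothesis SD : {ae P, forall w, S j w @[j --> \oo] --> D w}.
Hypothesis cauchy : forall i l,
  Ex P (fun w => (S i w - S (i + l)%N w) ^+ 2) <= eps i.
Hypothesis eps0 : eps j @[j --> \oo] --> 0.

(** (S i - D)^2 is the almost sure limit of (S i - S (i + l))^2 as l grows, so
    Fatou's lemma turns the Cauchy estimate into a rate towards D. The
    exceptional null set is removed from the domain of integration first. *)
Lemma L2_fatou i : (\int[P]_w ((S i w - D w) ^+ 2)%:E <= (eps i)%:E)%E.
Proof.
have mS k : measurable_fun setT (S k) by have [] := LS k.
pose f l w := ((S i w - S (i + l)%N w) ^+ 2)%:E.
have mf l : measurable_fun setT (f l).
  by apply/measurable_EFinP/measurable_funX/measurable_funB.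
have f0 l w : (0 <= f l w)%E by rewrite lee_fin sqr_ge0.
have [N [mN PN subN]] := SD.
rewrite (ge0_negligible_integral mN _ _ _ PN)//; last 2 first.
- by apply/measurable_EFinP/measurable_funX/measurable_funB.
- by move=> w _; rewrite lee_fin sqr_ge0.
have mNC : measurable (setT `\` N) by exact: measurableD.
rewrite (eq_integral (fun w => limn_einf (f ^~ w))); last first.
  move=> w; rewrite inE => -[_ Nw].
  have Sw : S j w @[j --> \oo] --> D w by apply: contrapT => h; apply: Nw; exact: subN.
  have fw : f ^~ w @ \oo --> ((S i w - D w) ^+ 2)%:E.
    apply: cvg_EFin; first by near=> l.
    have h : S i w - S (i + l)%N w @[l --> \oo] --> S i w - D w.
      apply: cvgB; first exact: cvg_cst.
      move: Sw; rewrite -(cvg_shiftn i (fun j => S j w)) => Sw.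
      by under eq_fun do rewrite addnC; exact: Sw.
    exact: (cvgM h h).
  by rewrite is_cvg_limn_einfE; [apply/esym/cvg_lim|apply/cvg_ex; eexists; exact: fw].
apply: le_trans (fatou _ mNC _ _) _ => //.
  by move=> l; exact: measurable_funTS.
have intf l : (\int[P]_(w in setT `\` N) f l w <= (eps i)%:E)%E.
  rewrite -(ge0_negligible_integral mN _ _ _ PN)//.
  have Lf : L1 P (fun w => (S i w - S (i + l)%N w) ^+ 2) by case: (L2B (LS i) (LS (i + l))).
  rewrite -[leLHS]fineK; last exact: integrable_fin_num.
  by rewrite lee_fin; exact: cauchy.
rewrite limn_einf_lim; apply: lime_le; first exact: is_cvg_einfs.
near=> n; apply: le_trans (intf n); apply: ereal_inf_lbound.
by exists n => //=.
Unshelve. all: by end_near. Qed.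

Lemma L2_limit i : L2 P D /\ Ex P (fun w => (S i w - D w) ^+ 2) <= eps i.
Proof.
have mSD : measurable_fun setT (fun w => S i w - D w).
  by apply: measurable_funB => //; have [] := LS i.
have sq : L1 P (fun w => (S i w - D w) ^+ 2).
  apply/integrableP; split; first by apply/measurable_EFinP; exact: measurable_funX.
  rewrite (eq_integral (fun w => ((S i w - D w) ^+ 2)%:E)); last first.
    by move=> w _; rewrite gee0_abs// lee_fin sqr_ge0.
  by apply: le_lt_trans (L2_fatou i) _; rewrite ltry.
split.
  have -> : D = (fun w => S i w - (S i w - D w)) by apply/funext => w; ring.
  by apply: L2B; [exact: LS|split].
rewrite -lee_fin /Ex /Rintegral fineK; first exact: L2_fatou.
exact: integrable_fin_num.
Qed.

Lemma L2_limit_mul (Q : T -> R) : L2 P Q ->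
  Ex P (fun w => S j w * Q w) @[j --> \oo] --> Ex P (fun w => D w * Q w).
Proof.
move=> LQ; have LD := (L2_limit 0).1.
apply/cvgrPdist_le => e e0; set q := Ex P (fun w => Q w ^+ 2).
have q0 : 0 <= q by apply: Ex_ge0 => w; exact: sqr_ge0.
pose K := (q + 1) / e.
have K0 : 0 < K by rewrite divr_gt0// ltr_wpDl.
have /cvgr0Pnorm_lt/(_ (e / K)) := eps0; rewrite divr_gt0// => /(_ isT) hK.
near=> j.
have hj : `|eps j| < e / K by near: j; exact: hK.
have [_ Dj] := L2_limit j.
rewrite distrC -ExB; [|exact: L2M|exact: L2M].
have -> : (fun w => S j w * Q w - D w * Q w) = (fun w => (S j w - D w) * Q w).
  by apply/funext => w; ring.
apply: le_trans (Ex_mul_bound K0 (L2B (LS j) LD) LQ) _.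
have h1 : K / 2 * Ex P (fun w => (S j w - D w) ^+ 2) <= e / 2.
  have : K * Ex P (fun w => (S j w - D w) ^+ 2) <= e.
    rewrite mulrC -ler_pdivlMr//; apply: le_trans Dj _.
    by apply: le_trans (ler_norm _) _; exact: ltW.
  lra.
have h2 : (2 * K)^-1 * q <= e / 2.
  rewrite /K -/q; have -> : (2 * ((q + 1) / e))^-1 * q = e / 2 * (q / (q + 1)).
    by field; rewrite !gt_eqF// ltr_wpDl.
  by rewrite ler_piMr ?divr_ge0 ?(ltW e0)// ler_pdivrMr ?ltr_wpDl// mul1r lerDl.
rewrite -/q; lra.
Unshelve. all: by end_near. Qed.

Lemma L2_limit_mean : Ex P (S j) @[j --> \oo] --> Ex P D.
Proof.
have := L2_limit_mul (L2_cst P 1).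
rewrite (_ : (fun w => D w * cst 1 w) = D); last by apply/funext => w; rewrite mulr1.
have Sj j : (fun w => S j w * cst 1 w) = S j by apply/funext => w; rewrite mulr1.
by under eq_fun do rewrite Sj.
Qed.

Lemma L2_limit_sq :
  Ex P (fun w => S j w ^+ 2) @[j --> \oo] --> Ex P (fun w => D w ^+ 2).
Proof.
have LD := (L2_limit 0).1; have [_ D2] := LD.
have sqE j : Ex P (fun w => S j w ^+ 2) =
    (2 * Ex P (fun w => S j w * D w) - Ex P (fun w => D w ^+ 2)) +
    Ex P (fun w => (S j w - D w) ^+ 2).
  have LSD := L2M (LS j) LD.
  rewrite -ExZ// -ExB//; last exact: L1Z.
  rewrite -ExD; [|apply: L1B => //; exact: L1Z|by case: (L2B (LS j) LD)].
  by congr Ex; apply/funext => w; ring.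
under eq_fun do rewrite sqE.
set D2E := Ex P (fun w => D w ^+ 2).
have DD : Ex P (fun w => D w * D w) = D2E.
  by congr Ex; apply/funext => w; rewrite expr2.
have lim1 : 2 * Ex P (fun w => S j w * D w) - D2E @[j --> \oo] --> 2 * D2E - D2E.
  apply: cvgB; last exact: cvg_cst.
  by rewrite -DD; apply: cvgMr; exact: L2_limit_mul.
have lim2 : Ex P (fun w => (S j w - D w) ^+ 2) @[j --> \oo] --> 0.
  apply: (squeeze_cvgr _ (cvg_cst 0) eps0); near=> j.
  by rewrite (L2_limit j).2 Ex_ge0// => w; exact: sqr_ge0.
have E0 : 2 * D2E - D2E + 0 = D2E by lra.
have lim := cvgD lim1 lim2; rewrite E0 in lim.
exact: lim.
Unshelve. all: by end_near. Qed.

End L2_limit.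

(** * Finite sums *)

Section sums.
Context {R : realType}.
Implicit Types (f z : nat -> R) (q : R).

(** A Riemann sum is unchanged when every cell is cut into p equal parts and the
    coefficient of the cell is kept on its parts. *)
Lemma sum_refine f z (m p : nat) : (0 < p)%N ->
  \sum_(k < m) f k * (z (k.+1 * p)%N - z (k * p)%N) =
  \sum_(k < m * p) f (k %/ p)%N * (z k.+1 - z k).
Proof.
move=> p0; elim: m => [|m IH]; first by rewrite mul0n !big_ord0.
rewrite big_ord_recr/= IH mulSn addnC.
rewrite -!(big_mkord xpredT (fun k => f (k %/ p)%N * (z k.+1 - z k))).
rewrite [in RHS](@big_cat_nat _ _ _ (m * p)%N)//=; last exact: leq_addr.
congr (_ + _); rewrite -(telescope_sumr z) ?leq_addr// mulr_sumr.
apply: eq_big_nat => i /andP[mi im]; congr (f _ * _); apply/esym/eqP.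
by rewrite eqn_leq leq_divRL// mi andbT -ltnS ltn_divLR// mulSn addnC.
Qed.

Lemma sum_geom q n : q != 1 -> \sum_(k < n) q ^+ k = (1 - q ^+ n) / (1 - q).
Proof.
move=> q1; have q1' : 1 - q != 0 by rewrite subr_eq0 eq_sym.
elim: n => [|n IH]; first by rewrite big_ord0 expr0 subrr mul0r.
by rewrite big_ord_recr/= IH exprS; field.
Qed.

Lemma sum_geom_rev q n : q != 1 ->
  \sum_(k < n) q ^+ (n - k.+1) = (1 - q ^+ n) / (1 - q).
Proof.
by move=> q1; rewrite -sum_geom// [RHS](reindex_inj rev_ord_inj).
Qed.

(** The index is |k - l| written with truncated subtractions. *)
Lemma sum_geom2 q n : q != 1 ->
  \sum_(k < n) \sum_(l < n) q ^+ ((k - l) + (l - k))%N =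
  n%:R * (1 + q) / (1 - q) - 2 * q * (1 - q ^+ n) / (1 - q) ^+ 2.
Proof.
move=> q1; have q1' : 1 - q != 0 by rewrite subr_eq0 eq_sym.
have inner m : \sum_(k < m) q ^+ ((m - k) + (k - m))%N = q * (1 - q ^+ m) / (1 - q).
  rewrite -mulrA -(sum_geom_rev m q1) mulr_sumr; apply: eq_bigr => k _.
  have -> : (k - m = 0)%N by apply/eqP; rewrite subn_eq0 ltnW.
  by rewrite addn0 -exprS -subSn// subSS.
elim: n => [|n IH]; first by rewrite !big_ord0 expr0 mul0r; field.
rewrite big_ord_recr/=.
under eq_bigr do rewrite big_ord_recr/=.
rewrite big_split/= IH big_ord_recr/= !subnn addn0 expr0.
under [X in _ + X + _]eq_bigr do rewrite addnC.
rewrite !inner (exprS q n) -(natr1 n); field.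
by rewrite q1'.
Qed.

Lemma sum_sqr_le n (f : 'I_n -> R) : (\sum_i f i) ^+ 2 <= n%:R * \sum_i f i ^+ 2.
Proof.
rewrite expr2 big_distrlr/=.
pose F := \sum_(i < n) \sum_(j < n) f i ^+ 2.
have FE : F = n%:R * \sum_i f i ^+ 2.
  rewrite mulr_sumr; apply: eq_bigr => i _.
  by rewrite sumr_const card_ord mulr_natl.
have FE' : \sum_(i < n) \sum_(j < n) f j ^+ 2 = F by rewrite exchange_big.
suff : \sum_(i < n) \sum_(j < n) f i * f j <= 2^-1 * (F + F) by rewrite -FE; lra.
rewrite -{2}FE' -big_split mulr_sumr; apply: ler_sum => i _.
rewrite -big_split mulr_sumr; apply: ler_sum => j _.
by have := sqr_ge0 (f i - f j); rewrite /= sqrrB; lra.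
Qed.

End sums.

(** * Moments of the Euler scheme *)

Section scheme.
Context d (T : measurableType d) (R : realType) (P : probability T R).
Variables (s : R) (W1 W2 N : R -> {RV P >-> R}).
Hypothesis s0 : 0 < s.
Hypothesis BW1 : brownian_motion W1.
Hypothesis BW2 : brownian_motion W2.
Hypothesis PN : poisson_process s N.
Hypothesis ind : independent_processes P
  (tnth [tuple (W1 : R -> T -> R); (W2 : R -> T -> R); (N : R -> T -> R)]).

Let fl u v w : R := flip (fun r => N r w) u v.

Let ifl u v : 0 <= u -> 0 <= v -> integrand N (fl u v).
Proof. by move=> u0 v0; exact: (integrand_flip N). Qed.

Lemma Ex_flip_le u v : 0 <= u -> u <= v -> Ex P (fl u v) = expR (- (2 * s * (v - u))).
Proof.
move=> u0; rewrite le_eqVlt => /predU1P[<-|uv].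
  rewrite subrr mulr0 oppr0 expR0 /fl.
  under [X in Ex P X]eq_fun do rewrite /flip subrr mulr0 cos0.
  exact: (Ex_cst P 1).
by rewrite (Ex_flip s0 PN u0 uv) mulrA.
Qed.

(** The jumps in the common part of (u, t] and (v, t] are counted twice and
    cancel, so only those between u and v matter. *)
Lemma Ex_flip_prod u v t : 0 <= u -> 0 <= v -> 0 <= t ->
  Ex P (fun w => fl u t w * fl v t w) = expR (- (2 * s * `|v - u|)).
Proof.
move=> u0 v0 t0; wlog uv : u v u0 v0 / u <= v => [H|].
  have [|/ltW vu] := leP u v; first exact: H.
  rewrite distrC -H//; congr Ex; apply/funext => w; exact: mulrC.
rewrite ger0_norm ?subr_ge0// -Ex_flip_le//.
have Lf : bounded_rv (fun w => fl u t w * fl v t w).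
  by apply: bdM; [case: (ifl u0 t0)|case: (ifl v0 t0)].
have [bf _] := ifl u0 v0.
apply: (L1_ae _ _ _ (bd_L1 P Lf)).2; [by case: Lf|by case: bf|].
have [aeN _ _] := PN.
apply: filterS aeN => w [_ Nnat _ _].
by rewrite mulrC /fl (flipC (fun r => N r w) v) flipM ?Nnat.
Qed.

Variable t : R.
Hypothesis t0 : 0 < t.
Variables (x dl c1 c2 : R).
Let h (j : nat) : R := t / (2 ^ j)%:R.
Let g j k := grid t j k.

Let t0' : 0 <= t. Proof. exact: ltW. Qed.
Let g0 j k : 0 <= g j k. Proof. by rewrite -(grid0 t j); exact: grid_homo. Qed.
Let h0 j : 0 < h j. Proof. by rewrite divr_gt0// pow2_gt0. Qed.
Let hn j : h j * (2 ^ j)%:R = t. Proof. by rewrite /h mulfVK// gt_eqF// pow2_gt0. Qed.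

Definition scheme_coef j k (w : T) : R := fl (g j k.+1) t w.

Definition scheme_drift j w : R :=
  x * fl 0 t w + dl * h j * \sum_(k < 2 ^ j) scheme_coef j k w.

Definition scheme_noise j w : R := noise_sum W1 W2 t j c1 c2 (scheme_coef j) w.

(** The Euler scheme at time t for D = Z - 2 int D_- dN driven by
    Z_v = x + dl v + c1 W1_v + c2 W2_v, on the dyadic grid of level j. Its drift
    part depends on the Poisson process only and its noise part has mean zero
    given that process, hence the two are orthogonal. *)
Definition scheme j w : R := scheme_drift j w + scheme_noise j w.

Let icoef j k : integrand N (scheme_coef j k). Proof. exact: ifl. Qed.

Let idrift j : integrand N (scheme_drift j).
Proof.
apply: integrandD; first by apply: integrandM; [exact: integrand_cst|exact: ifl].
apply: integrandM; first exact: integrand_cst.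
by apply: integrand_sum => k; exact: icoef.
Qed.

Let Lnoise j : L2 P (scheme_noise j).
Proof. by apply: noise_sum_L2 => // k; exact: icoef. Qed.

Let Ldrift j : L2 P (scheme_drift j).
Proof. by apply: bd_L2; case: (idrift j). Qed.

Lemma scheme_L2 j : L2 P (scheme j). Proof. exact: L2D. Qed.

Let q j : R := expR (- (2 * s * h j)).
Let e : R := expR (- (2 * s * t)).

Let qn j : q j ^+ (2 ^ j) = e.
Proof. by rewrite -expRM_natl -mulrN mulrA [_ * (2 * s)]mulrC -mulrA [_ * - h j]mulrN (mulrC _ (h j)) hn mulrN. Qed.

Let q1 j : q j != 1.
Proof. by rewrite lt_eqF// -expR0 ltr_expR oppr_lt0 !mulr_gt0. Qed.

Let gridB j k l : (k <= l)%N -> g j l - g j k = h j * (l - k)%:R.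
Proof. by move=> kl; rewrite /g /grid /h natrB//; field; rewrite gt_eqF// pow2_gt0. Qed.

Let expRh j k : expR (- (2 * s * (h j * k%:R))) = q j ^+ k.
Proof. by rewrite -expRM_natl; congr expR; ring. Qed.

Let glast j : g j (2 ^ j) = t. Proof. exact: grid_last. Qed.

Let Ecoef j k : (k < 2 ^ j)%N -> Ex P (scheme_coef j k) = q j ^+ (2 ^ j - k.+1).
Proof.
move=> kj; rewrite Ex_flip_le//.
  by rewrite -[X in X - _](glast j) gridB// expRh.
by rewrite -[leRHS](glast j); exact: grid_homo.
Qed.

Let Esum j : Ex P (fun w => \sum_(k < 2 ^ j) scheme_coef j k w) =
  (1 - e) / (1 - q j).
Proof.
rewrite Ex_sum; last by move=> k; apply: bd_L1; case: (icoef j k).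
under eq_bigr do rewrite Ecoef//.
by rewrite sum_geom_rev// qn.
Qed.

Let Efl0 : Ex P (fl 0 t) = e.
Proof. by rewrite Ex_flip_le// subr0. Qed.

Let bsum j : bounded_rv (fun w => \sum_(k < 2 ^ j) scheme_coef j k w).
Proof. by apply: bd_sum => k; case: (icoef j k). Qed.

Let bfl0 : bounded_rv (fl 0 t). Proof. by case: (ifl (lexx 0) t0'). Qed.

(** The coefficients have means q^(n - k - 1) with q = exp(-2 s h) and n = 2^j, and
    q^n = exp(-2 s t). *)
Lemma scheme_mean j :
  Ex P (scheme j) = x * e + dl * (h j / (1 - q j)) * (1 - e).
Proof.
rewrite /scheme ExD; [|exact: L2_L1|exact: L2_L1].
have -> : Ex P (scheme_noise j) = 0.
  have := noise_sum_mean BW1 BW2 ind j t0' c1 c2 (integrand_cst N 1) (icoef j).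
  by under [X in Ex P X = _ -> _]eq_fun do rewrite mul1r.
rewrite addr0 /scheme_drift ExD; [|by apply/L1Z/bd_L1|by apply/L1Z/bd_L1].
by rewrite !ExZ ?Efl0 ?Esum; [ring|exact: bd_L1|exact: bd_L1].
Qed.

Let Ecoef2 j k l : Ex P (fun w => scheme_coef j k w * scheme_coef j l w) =
  q j ^+ ((k - l) + (l - k))%N.
Proof.
rewrite Ex_flip_prod// -expRh; congr (expR (- (_ * _))).
have [kl|/ltnW lk] := leqP k l.
  rewrite gridB// subSS ger0_norm; last by rewrite mulr_ge0// ltW.
  by rewrite (eqP (_ : (k - l)%N == 0%N)) ?subn_eq0// add0n.
rewrite distrC gridB// subSS ger0_norm; last by rewrite mulr_ge0// ltW.
by rewrite (eqP (_ : (l - k)%N == 0%N)) ?subn_eq0// addn0.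
Qed.

Let Ecoef0 j k : Ex P (fun w => fl 0 t w * scheme_coef j k w) = q j ^+ k.+1.
Proof.
rewrite Ex_flip_prod// -(grid0 t j) gridB// subn0 ger0_norm ?expRh//.
by rewrite mulr_ge0// ltW.
Qed.

Let Efl02 : Ex P (fun w => fl 0 t w ^+ 2) = 1.
Proof.
under [X in Ex P X]eq_fun do rewrite expr2.
by rewrite Ex_flip_prod// subrr normr0 mulr0 oppr0 expR0.
Qed.

(** The noise contributes (c1^2 + c2^2) t exactly, because its coefficients are
    signs; the drift is a double geometric sum. *)
Lemma scheme_second_moment j : let r := h j / (1 - q j) in
  Ex P (fun w => scheme j w ^+ 2) =
    x ^+ 2 + 2 * x * dl * q j * r * (1 - e)
    + dl ^+ 2 * (t * r * (1 + q j) - 2 * q j * r ^+ 2 * (1 - e))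
    + (c1 ^+ 2 + c2 ^+ 2) * t.
Proof.
move=> r.
have q1' : 1 - q j != 0 by rewrite subr_eq0 eq_sym.
have -> : (fun w => scheme j w ^+ 2) = (fun w =>
   (scheme_drift j w ^+ 2 + 2 * (scheme_drift j w * scheme_noise j w)) +
   scheme_noise j w * scheme_noise j w).
  by apply/funext => w; rewrite /scheme; ring.
have LL := L2M (Lnoise j) (Lnoise j).
have [_ Ldd] := Ldrift j; have Ldn := L2M (Ldrift j) (Lnoise j).
rewrite ExD//; last by apply: L1D => //; exact: L1Z.
rewrite ExD//; last exact: L1Z.
rewrite ExZ// (noise_sum_mean BW1 BW2 ind j t0' c1 c2 (idrift j) (icoef j)) mulr0 addr0.
rewrite (noise_isometry BW1 BW2 ind j t0' c1 c2 c1 c2 (icoef j) (icoef j)).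
have -> : \sum_(k < 2 ^ j) Ex P (fun w => scheme_coef j k w * scheme_coef j k w)
    = (2 ^ j)%:R.
  under eq_bigr do rewrite Ecoef2 subnn addn0 expr0.
  by rewrite sumr_const card_ord.
rewrite -/(h j) -mulrA hn -!expr2; congr (_ + _).
have -> : (fun w => scheme_drift j w ^+ 2) = (fun w =>
   (x ^+ 2 * fl 0 t w ^+ 2 +
    (2 * x * dl * h j) * (\sum_(k < 2 ^ j) fl 0 t w * scheme_coef j k w)) +
   (dl * h j) ^+ 2 * (\sum_(k < 2 ^ j) \sum_(l < 2 ^ j) scheme_coef j k w * scheme_coef j l w)).
  apply/funext => w; rewrite /scheme_drift -mulr_sumr -big_distrlr/=; ring.
have bc2 k l : bounded_rv (fun w => scheme_coef j k w * scheme_coef j l w).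
  by apply: bdM; [case: (icoef j k)|case: (icoef j l)].
have b0c k : bounded_rv (fun w => fl 0 t w * scheme_coef j k w).
  by apply: bdM => //; case: (icoef j k).
have Lss : L1 P (fun w => \sum_(k < 2 ^ j) \sum_(l < 2 ^ j) scheme_coef j k w * scheme_coef j l w).
  by apply: bd_L1; apply: bd_sum => k; apply: bd_sum.
have Ls : L1 P (fun w => \sum_(k < 2 ^ j) fl 0 t w * scheme_coef j k w).
  by apply: bd_L1; apply: bd_sum.
have [_ L0] := bd_L2 P bfl0.
rewrite ExD; [|by apply: L1D; exact: L1Z|exact: L1Z].
rewrite ExD; [|exact: L1Z|exact: L1Z].
rewrite !ExZ// Efl02 Ex_sum; last by move=> k; exact: bd_L1.
rewrite Ex_sum; last by move=> k; apply: bd_L1; apply: bd_sum.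
have -> : \sum_(k < 2 ^ j) Ex P (fun w => \sum_(l < 2 ^ j) scheme_coef j k w * scheme_coef j l w)
   = (2 ^ j)%:R * (1 + q j) / (1 - q j) - 2 * q j * (1 - e) / (1 - q j) ^+ 2.
  rewrite -(qn j) -sum_geom2//; apply: eq_bigr => k _.
  rewrite Ex_sum; last by move=> l; exact: bd_L1.
  by apply: eq_bigr => l _; rewrite Ecoef2.
have -> : \sum_(k < 2 ^ j) Ex P (fun w => fl 0 t w * scheme_coef j k w) =
    q j * (1 - e) / (1 - q j).
  under eq_bigr do rewrite Ecoef0 exprS.
  by rewrite -mulr_sumr sum_geom// qn mulrA.
rewrite mulr1 /r -[in RHS](hn j).
by field; rewrite q1'.
Qed.

Definition noise_total (b1 b2 : R) w : R :=
  b1 * (W1 t w - W1 0 w) + b2 * (W2 t w - W2 0 w).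

Let tele (W : R -> {RV P >-> R}) j w :
  \sum_(k < 2 ^ j) (W (grid t j k.+1) w - W (grid t j k) w) = W t w - W 0 w.
Proof.
rewrite -(big_mkord xpredT (fun k => W (grid t j k.+1) w - W (grid t j k) w)).
by rewrite (telescope_sumr (fun k => W (grid t j k) w))// grid_last grid0.
Qed.

Lemma noise_totalE j b1 b2 :
  noise_total b1 b2 = noise_sum W1 W2 t j b1 b2 (fun=> cst 1).
Proof.
apply/funext => w; rewrite /noise_sum /noise_total.
under eq_bigr do rewrite mul1r /noise.
rewrite big_split/= -!mulr_sumr.
by rewrite !tele.
Qed.

Lemma noise_total_L2 b1 b2 : L2 P (noise_total b1 b2).
Proof.
have -> : noise_total b1 b2 = noise W1 W2 t 0 b1 b2 0.
  by apply/funext => w; rewrite /noise grid0 (grid_last t 0).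
exact: noise_L2.
Qed.

Lemma noise_total_mean b1 b2 : Ex P (noise_total b1 b2) = 0.
Proof.
have := noise_sum_mean BW1 BW2 ind 0 t0' b1 b2 (integrand_cst N 1)
  (fun=> integrand_cst N 1).
by rewrite -noise_totalE; under [X in Ex P X = _ -> _]eq_fun do rewrite mul1r.
Qed.

Lemma noise_total_sq b1 b2 :
  Ex P (fun w => noise_total b1 b2 w ^+ 2) = (b1 ^+ 2 + b2 ^+ 2) * t.
Proof.
under [X in Ex P X]eq_fun do rewrite expr2.
rewrite (noise_totalE 0) (noise_isometry BW1 BW2 ind 0 t0' b1 b2 b1 b2
  (fun=> integrand_cst N 1) (fun=> integrand_cst N 1)).
rewrite expn0 big_ord1 divr1 (_ : (fun w => _) = cst 1 :> (T -> R)); last first.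
  by apply/funext => w; rewrite mulr1.
by rewrite Ex_cst; ring.
Qed.

(** The total noise has constant coefficient 1, so the isometry leaves the mean
    of the coefficients of the scheme. *)
Lemma scheme_noise_total j b1 b2 :
  Ex P (fun w => scheme j w * noise_total b1 b2 w) =
  (c1 * b1 + c2 * b2) * (h j / (1 - q j)) * (1 - e).
Proof.
rewrite /scheme; under [X in Ex P X]eq_fun do rewrite mulrDl.
have LT := noise_total_L2 b1 b2.
rewrite ExD; [|exact: L2M|exact: L2M].
rewrite (noise_totalE j) (noise_sum_mean BW1 BW2 ind j t0' b1 b2 (idrift j))//;
  last by move=> k; exact: integrand_cst.
rewrite add0r (noise_isometry BW1 BW2 ind j t0' c1 c2 b1 b2 (icoef j)
  (fun=> integrand_cst N 1)).
under eq_bigr => k _.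
  under [X in Ex P X]eq_fun do rewrite mulr1.
  rewrite Ecoef//; over.
by rewrite sum_geom_rev// qn -/(h j); ring.
Qed.

(** * Convergence of the Euler scheme in L2 *)

Let path j k w : R := dl * g j k + (c1 * W1 (g j k) w + c2 * W2 (g j k) w).

Let scheme_path j w : scheme j w = x * fl 0 t w +
  \sum_(k < 2 ^ j) scheme_coef j k w * (path j k.+1 w - path j k w).
Proof.
rewrite /scheme /scheme_drift -addrA; congr (_ + _).
rewrite mulr_sumr -big_split/=; apply: eq_bigr => k _.
rewrite /path /noise -/(g j k) -/(g j k.+1).
have -> : h j = g j k.+1 - g j k by rewrite [RHS]gridS.
ring.
Qed.

(** The level i scheme rewritten on the grid of level i + l has the coefficients of
    the parent cells; this is the difference with the coefficients of level i + l. *)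
Definition scheme_gap i l k w : R :=
  scheme_coef i (k %/ 2 ^ l) w - scheme_coef (i + l) k w.

Let igap i l k : integrand N (scheme_gap i l k).
Proof. exact: integrandB. Qed.

Let scheme_diff i l w : scheme i w - scheme (i + l) w =
  dl * h (i + l) * (\sum_(k < 2 ^ (i + l)) scheme_gap i l k w) +
  noise_sum W1 W2 t (i + l) c1 c2 (scheme_gap i l) w.
Proof.
rewrite !scheme_path.
have -> : \sum_(k < 2 ^ i) scheme_coef i k w * (path i k.+1 w - path i k w) =
    \sum_(k < 2 ^ (i + l)) scheme_coef i (k %/ 2 ^ l) w *
      (path (i + l) k.+1 w - path (i + l) k w).
  rewrite [in RHS]expnD -(sum_refine (fun k => scheme_coef i k w)
    (fun k => path (i + l) k w)) ?expn_gt0//.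
  by apply: eq_bigr => k _; rewrite /path /g -!grid_refine.
rewrite opprD addrACA subrr add0r -sumrB mulr_sumr -big_split/=.
apply: eq_bigr => k _; rewrite /path /noise /scheme_gap -/(g _ k) -/(g _ k.+1).
have -> : h (i + l) = g (i + l) k.+1 - g (i + l) k by rewrite [RHS]gridS.
ring.
Qed.

(** Both coefficients are signs, so the expectation is 2 - 2 exp(-2 s a) where a,
    the distance of the right ends of the cell and of its parent, is at most the
    mesh of level i. *)
Let Egap i l k : Ex P (fun w => scheme_gap i l k w * scheme_gap i l k w) <= 4 * s * h i.
Proof.
pose c := scheme_coef i (k %/ 2 ^ l); pose c' := scheme_coef (i + l) k.
have ic : integrand N c by exact: icoef.
have ic' : integrand N c' by exact: icoef.
have LM f f' : integrand N f -> integrand N f' -> L1 P (fun w => f w * f' w).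
  by move=> [bf _] [bf' _]; apply: bd_L1; exact: bdM.
have -> : (fun w => scheme_gap i l k w * scheme_gap i l k w) =
    (fun w => (c w * c w + c' w * c' w) - 2 * (c w * c' w)).
  by apply/funext => w; rewrite /scheme_gap -/(c w) -/(c' w); ring.
rewrite ExB; [|apply: L1D; exact: LM|apply: L1Z; exact: LM].
rewrite ExD; [|exact: LM|exact: LM].
rewrite ExZ; last exact: LM.
rewrite !Ex_flip_prod// !subrr !normr0 !mulr0 !oppr0 !expR0.
set a := `| _ |.
have [le1 le2] := grid_parent i l k t0'.
have a_le : a <= h i.
  have := gridS t i (k %/ 2 ^ l); rewrite -/(h i) => <-.
  rewrite /a distrC ger0_norm ?subr_ge0// lerD2l lerN2.
  by rewrite (le_trans le1)// grid_homo.
have := expR_ge1Dx (- (2 * s * a)); have : s * a <= s * h i by rewrite ler_pM2l.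
lra.
Qed.

Definition scheme_rate j : R := (dl ^+ 2 * t + (c1 ^+ 2 + c2 ^+ 2)) * t * (4 * s * h j).

(** By the isometry the noise part is a mean of squared gaps; the drift part is
    too, by Cauchy-Schwarz. *)
Lemma scheme_cauchy i l :
  Ex P (fun w => (scheme i w - scheme (i + l) w) ^+ 2) <= scheme_rate i.
Proof.
pose n := (2 ^ (i + l))%N; pose b := scheme_gap i l.
pose A w := dl * h (i + l) * \sum_(k < n) b k w.
pose M := noise_sum W1 W2 t (i + l) c1 c2 b.
have iA : integrand N A.
  apply: integrandM; first exact: integrand_cst.
  by apply: integrand_sum => k; exact: igap.
have [_ LAA] : L2 P A by apply: bd_L2; case: iA.
have LM : L2 P M by apply: (noise_sum_L2 BW1 BW2 _ t0') => k; exact: igap.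
have LMM := L2M LM LM.
have LAM := L1_bdM iA.1 (L2_L1 LM).
have -> : (fun w => (scheme i w - scheme (i + l) w) ^+ 2) =
    (fun w => (A w ^+ 2 + 2 * (A w * M w)) + M w * M w).
  by apply/funext => w; rewrite scheme_diff -/(A w) -/(M w); ring.
rewrite ExD//; last by apply: L1D => //; exact: L1Z.
rewrite ExD//; last exact: L1Z.
rewrite ExZ// (noise_sum_mean BW1 BW2 ind _ t0' c1 c2 iA (igap i l)) mulr0 addr0.
rewrite (noise_isometry BW1 BW2 ind _ t0' c1 c2 c1 c2 (igap i l) (igap i l)).
set V := \sum_(k < _) _; rewrite -/(h (i + l)).
have bb k : L1 P (fun w => b k w * b k w).
  by apply: bd_L1; apply: bdM; case: (igap i l k).
have V_le : V <= n%:R * (4 * s * h i).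
  rewrite -[n in n%:R]card_ord mulr_natl -sumr_const; apply: ler_sum => k _.
  exact: Egap.
have A_le : Ex P (fun w => A w ^+ 2) <= dl ^+ 2 * h (i + l) ^+ 2 * n%:R * V.
  have -> : V = Ex P (fun w => \sum_(k < n) b k w * b k w).
    by rewrite Ex_sum// => k; exact: bb.
  have Lb : L1 P (fun w => \sum_(k < n) b k w * b k w) by apply: L1_sum => k; exact: bb.
  rewrite -ExZ//; apply: Ex_le => //; first exact: L1Z.
  move=> w; rewrite /A exprMn exprMn -[leRHS]mulrA; apply: ler_wpM2l.
    by rewrite mulr_ge0 ?sqr_ge0.
  apply: le_trans (sum_sqr_le _) _.
  by under eq_bigr do rewrite expr2.
have hnt := hn (i + l); rewrite -/n in hnt.
have hh : 0 <= h (i + l) by exact: ltW.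
rewrite -!expr2; apply: le_trans (lerD A_le (lexx _)) _.
have -> : dl ^+ 2 * h (i + l) ^+ 2 * n%:R * V + (c1 ^+ 2 + c2 ^+ 2) * h (i + l) * V =
    (dl ^+ 2 * t + (c1 ^+ 2 + c2 ^+ 2)) * h (i + l) * V.
  by rewrite -{1}hnt; ring.
have -> : scheme_rate i = (dl ^+ 2 * t + (c1 ^+ 2 + c2 ^+ 2)) * h (i + l) *
    (n%:R * (4 * s * h i)).
  by rewrite /scheme_rate -[X in _ * X * (4 * _ * _)]hnt; ring.
apply: ler_wpM2l V_le; rewrite mulr_ge0// !addr_ge0 ?sqr_ge0//.
by rewrite mulr_ge0 ?sqr_ge0.
Qed.

Let h_cvg : h j @[j --> \oo] --> 0.
Proof.
rewrite (_ : 0 = t * 0); last by rewrite mulr0.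
rewrite /h; apply: cvgMr.
rewrite (_ : (fun j => _) = (fun j => (2^-1) ^+ j)); last first.
  by apply/funext => j; rewrite natrX exprVn.
by apply: cvg_expr; rewrite ger0_norm ?invr_ge0// invf_lt1// ltr1n.
Qed.

Lemma scheme_rate_cvg : scheme_rate j @[j --> \oo] --> 0.
Proof.
rewrite /scheme_rate.
rewrite [X in _ --> X](_ : 0 = (dl ^+ 2 * t + (c1 ^+ 2 + c2 ^+ 2)) * t * (4 * s * 0));
  last by rewrite !mulr0.
by do 2 apply: cvgMr.
Qed.

(** The squeeze comes from exp(y) >= 1 + y at y = -2 s h and y = 2 s h. *)
Lemma step_ratio_cvg : h j / (1 - q j) @[j --> \oo] --> (2 * s)^-1.
Proof.
have q_cvg : expR (2 * s * h j) @[j --> \oo] --> (1 : R).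
  rewrite -[X in _ --> X](expR0) -[X in expR X](mulr0 (2 * s)).
  apply: (continuous_cvg _ (@continuous_expR R _)); exact: cvgMr.
have up : (2 * s)^-1 * expR (2 * s * h j) @[j --> \oo] --> (2 * s)^-1.
  by rewrite -[X in _ --> X]mulr1; exact: cvgMr.
apply: (squeeze_cvgr _ (cvg_cst _) up); near=> j.
have q_lt : 0 < 1 - q j by rewrite subr_gt0 lt_neqAle q1 -expR0 ler_expR oppr_le0 !mulr_ge0// ltW.
have b0 : 0 < 2 * s by rewrite mulr_gt0.
have Q0 := expR_gt0 (2 * s * h j).
have QE : expR (2 * s * h j) * q j = 1 by rewrite /q expRN mulfV// gt_eqF.
apply/andP; split.
  rewrite ler_pdivlMr// mulrC ler_pdivrMr//.
  by have := expR_ge1Dx (- (2 * s * h j)); rewrite -/(q j); lra.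
rewrite ler_pdivrMr// -[leRHS]mulrA ler_pdivlMl// mulrBr QE mulr1.
by have := expR_ge1Dx (2 * s * h j); lra.
Unshelve. all: by end_near. Qed.

Lemma step_decay_cvg : q j @[j --> \oo] --> (1 : R).
Proof.
rewrite -[X in _ --> X]expR0 /q -[X in expR X]oppr0 -[X in - X](mulr0 (2 * s)).
apply: (continuous_cvg _ (@continuous_expR R _)); apply: cvgN; exact: cvgMr.
Qed.

Section limit.
Variable D : T -> R.
Hypothesis mD : measurable_fun setT D.
Hypothesis SD : {ae P, forall w, scheme j w @[j --> \oo] --> D w}.

Lemma scheme_limit_L2 : L2 P D.
Proof. exact: (L2_limit scheme_L2 mD SD scheme_cauchy 0).1. Qed.

Lemma scheme_limit_mean : Ex P D = x * e + dl / (2 * s) * (1 - e).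
Proof.
have := L2_limit_mean scheme_L2 mD SD scheme_cauchy scheme_rate_cvg.
under eq_fun do rewrite scheme_mean; move=> lim; apply: (cvg_unique _ lim) => //.
apply: cvgD; first exact: cvg_cst.
by apply: cvgMl; apply: cvgMr; exact: step_ratio_cvg.
Qed.

Lemma scheme_limit_sq : Ex P (fun w => D w ^+ 2) =
  x ^+ 2 + x * dl / s * (1 - e)
  + dl ^+ 2 * (t / s - (1 - e) / (2 * s ^+ 2)) + (c1 ^+ 2 + c2 ^+ 2) * t.
Proof.
have := L2_limit_sq scheme_L2 mD SD scheme_cauchy scheme_rate_cvg.
under eq_fun do rewrite scheme_second_moment; move=> lim; apply: (cvg_unique _ lim) => //.
(* The limit is written as the second moment of the scheme at q = 1 and
   h / (1 - q) = 1 / (2 s). *)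
have -> : x ^+ 2 + x * dl / s * (1 - e)
  + dl ^+ 2 * (t / s - (1 - e) / (2 * s ^+ 2)) + (c1 ^+ 2 + c2 ^+ 2) * t =
  x ^+ 2 + 2 * x * dl * 1 * (2 * s)^-1 * (1 - e)
    + dl ^+ 2 * (t * (2 * s)^-1 * (1 + 1) - 2 * 1 * (2 * s)^-1 ^+ 2 * (1 - e))
    + (c1 ^+ 2 + c2 ^+ 2) * t.
  by field; rewrite gt_eqF.
have rc := step_ratio_cvg; have qc := step_decay_cvg.
apply: cvgD; last exact: cvg_cst.
apply: cvgD.
  apply: cvgD; first exact: cvg_cst.
  apply: cvgMl; apply: cvgM; last exact: rc.
  exact: cvgMr.
apply: cvgMr; apply: cvgB.
  apply: cvgM; first exact: cvgMr.
  by apply: cvgD; first exact: cvg_cst.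
apply: cvgMl; apply: cvgM; first exact: cvgMr.
exact: (cvgM rc rc).
Qed.

Lemma scheme_limit_noise b1 b2 : Ex P (fun w => D w * noise_total b1 b2 w) =
  (c1 * b1 + c2 * b2) / (2 * s) * (1 - e).
Proof.
have := L2_limit_mul scheme_L2 mD SD scheme_cauchy scheme_rate_cvg (noise_total_L2 b1 b2).
under eq_fun do rewrite scheme_noise_total; move=> lim; apply: (cvg_unique _ lim) => //.
by apply: cvgMl; apply: cvgMr; exact: step_ratio_cvg.
Qed.
End limit.

(** * Almost sure convergence of the Euler scheme *)

Let bad i k : set T := [set w | ~ (N (g i k.+1) w - N (g i k) w = 0 \/
                                   N (g i k.+1) w - N (g i k) w = 1)].

Let mbad i k : measurable (bad i k).
Proof.
have mf : measurable_fun setT (fun w => N (g i k.+1) w - N (g i k) w).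
  exact: measurable_funB.
have := mf measurableT _ (measurableC (measurableU _ _ (measurable_set1 (0 : R))
  (measurable_set1 (1 : R)))).
by rewrite setTI.
Qed.

Let Pbad i : (P (\bigcup_(k < 2 ^ i) bad i k) <= (s ^+ 2 * t * h i)%:E)%E.
Proof.
rewrite bigcup_mkord; apply: le_trans (Boole_inequality _ _) _.
  by move=> k _; exact: mbad.
have hE : s ^+ 2 * t * h i = \sum_(k < 2 ^ i) (s * h i) ^+ 2.
  by rewrite sumr_const card_ord -(mulr_natr _ (2 ^ i)) -{1}(hn i); ring.
rewrite hE -sumEFin; apply: lee_sum => k _.
have st : g i k.+1 - g i k = h i by exact: gridS.
have := poisson_two_jumps s0 PN (g0 i k) (_ : g i k < g i k.+1); rewrite st; apply.
by rewrite -subr_gt0 st.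
Qed.

(** At level i a cell with two jumps exists with probability at most
    2^i (s h)^2 = s^2 t h, which tends to 0: failure at all levels at once has
    probability 0. *)
Lemma single_jump_cells : {ae P, forall w, exists i, forall k, (k < 2 ^ i)%N ->
  N (g i k.+1) w - N (g i k) w = 0 \/ N (g i k.+1) w - N (g i k) w = 1}.
Proof.
have mB i : measurable (\bigcup_(k < 2 ^ i) bad i k).
  by apply: bigcup_measurable => k _; exact: mbad.
exists (\bigcap_i \bigcup_(k < 2 ^ i) bad i k); split.
- exact: bigcapT_measurable.
- apply/eqP; rewrite eq_le measure_ge0 andbT.
  have lim : (s ^+ 2 * t * h j)%:E @[j --> \oo] --> (0 : R)%:E.
    apply: cvg_EFin; first by near=> j.
    by rewrite -[X in _ --> X](mulr0 (s ^+ 2 * t)); exact: cvgMr.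
  rewrite -[leRHS](cvg_lim (@ereal_hausdorff R) lim).
  apply: lime_ge; first by apply/cvg_ex; eexists; exact: lim.
  near=> j; apply: le_trans (Pbad j); apply: le_measure; rewrite ?inE//.
    exact: bigcapT_measurable.
  exact: bigcap_inf.
- move=> w /= nw i _; apply: contrapT => hw; apply: nw; exists i => k ki.
  by apply: contrapT => b; apply: hw; exists k.
Unshelve. all: by end_near. Qed.

Lemma scheme_cvg (D : R -> T -> R) :
  {ae P, forall w, forall v, 0 <= v -> D v w =
    x + dl * v + (c1 * W1 v w + c2 * W2 v w)
      - 2 * jump_integral (fun u => D u w) (fun u => N u w) v} ->
  {ae P, forall w, scheme j w @[j --> \oo] --> D t w}.
Proof.
have [aeW1 _ _] := BW1; have [aeW2 _ _] := BW2; have [aeN _ _] := PN.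
move=> aeD.
have FP := ae_filter_ringOfSetsType P.
apply: (filterS _ (filterI (filterI aeW1 aeW2) (filterI aeN (filterI aeD single_jump_cells)))) => w [[[W10 cW1] [W20 cW2]] [cN [DE cells]]].
pose Z v := x + dl * v + (c1 * W1 v w + c2 * W2 v w).
have cZ : {within `[0, +oo[, continuous Z}.
  have cl : {within `[0, +oo[, continuous (fun v : R => x + dl * v)}.
    by apply: continuous_subspaceT => v; apply: cvgD; [exact: cvg_cst|exact: cvgMr].
  move=> v; apply: cvgD; first exact: cl.
  apply: cvgD; apply: cvgMr; [exact: cW1|exact: cW2].
have := euler_cvg cN cZ DE t0 cells; apply: cvg_trans; apply: near_eq_cvg; near=> j.
rewrite /euler scheme_path /Z W10 W20 !mulr0 !addr0 mulrC; congr (_ + _).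
by apply: eq_bigr => k _; congr (_ * _); rewrite /path /g; ring.
Unshelve. all: by end_near. Qed.

End scheme.

(** * Sum and difference of the swapping coordinates *)

Section covariances.
Context d (T : measurableType d) (R : realType) (P : probability T R).

Lemma covariance_Ex (f g : T -> R) : L2 P f -> L2 P g ->
  covariance P f g = (Ex P (fun w => f w * g w) - Ex P f * Ex P g)%:E.
Proof.
move=> Lf Lg; have Lfg := L2M Lf Lg.
rewrite covarianceE; [|exact/Lfun1_integrable/L2_L1..|exact/Lfun1_integrable].
by rewrite !ExE//; exact: L2_L1.
Qed.

Lemma L2_ae (f g : T -> R) : measurable_fun setT g ->
  {ae P, forall w, f w = g w} -> L2 P f -> L2 P g.
Proof.
move=> mg fg [mf f2]; split=> //.
have mf2 := measurable_funX 2 mf; have mg2 := measurable_funX 2 mg.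
by apply: (L1_ae mf2 mg2 _ f2).1; apply: filterS fg => w ->.
Qed.

End covariances.

Section swapping_moments.
Context d (T : measurableType d) (R : realType) (P : probability T R).
Variables (mu1 mu2 sigma1 sigma2 s x0 y0 : R) (X Y : R -> {RV P >-> R}).
Hypothesis s0 : 0 < s.
Hypothesis hXY : brownian_swapping_process mu1 mu2 sigma1 sigma2 s x0 y0 X Y.
Variable t : R.
Hypothesis t0 : 0 < t.
Let e : R := expR (- (2 * s * t)).
Let S w := X t w + Y t w.
Let D w := X t w - Y t w.
Let K : R := x0 + y0 + (mu1 + mu2) * t.
Let mD : R := (x0 - y0) * e + (mu1 - mu2) / (2 * s) * (1 - e).

(** In S the jump integrals of the two equations cancel, so S is an affine function
    of the total noise. D solves D = Z - 2 int D_- dN with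
    Z = x0 - y0 + (mu1 - mu2) v + sigma1 W1 - sigma2 W2, so it is the limit of the
    Euler scheme. *)
Lemma swapping_moments :
  [/\ L2 P S /\ L2 P D, Ex P S = K /\ Ex P D = mD,
      Ex P (fun w => S w ^+ 2) = K ^+ 2 + (sigma1 ^+ 2 + sigma2 ^+ 2) * t,
      Ex P (fun w => D w ^+ 2) = (x0 - y0) ^+ 2 + (x0 - y0) * (mu1 - mu2) / s * (1 - e)
        + (mu1 - mu2) ^+ 2 * (t / s - (1 - e) / (2 * s ^+ 2))
        + (sigma1 ^+ 2 + sigma2 ^+ 2) * t
    & Ex P (fun w => S w * D w) =
        K * mD + (sigma1 ^+ 2 - sigma2 ^+ 2) / (2 * s) * (1 - e)].
Proof.
have [W1 [W2 [N [BW1 BW2 PN ind sde]]]] := hXY.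
pose M := noise_total W1 W2 t sigma1 sigma2.
have mS : measurable_fun setT S by exact: measurable_funD.
have mDf : measurable_fun setT D by exact: measurable_funB.
have jumpXY w u : cadlag (fun r => X r w) -> cadlag (fun r => Y r w) ->
    jump_integral (fun r => Y r w - X r w) (fun r => N r w) u =
    - jump_integral (fun r => X r w - Y r w) (fun r => N r w) u.
  move=> [_ lX] [_ lY].
  have -> : (fun r => Y r w - X r w) = (fun r => - (X r w - Y r w)).
    by apply/funext => r; rewrite opprB.
  by rewrite jump_integralN// => r r0; apply: is_cvgB; [exact: lX|exact: lY].
have aeS : {ae P, forall w, K + M w = S w}.
  have [aeW1 _ _] := BW1; have [aeW2 _ _] := BW2.
  have FP := ae_filter_ringOfSetsType P.
  apply: (filterS _ (filterI (filterI aeW1 aeW2) sde)) => w [[[W10 _] [W20 _]] [cX cY XY]].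
  rewrite /S; have [-> ->] := XY _ (ltW t0).
  by rewrite jumpXY// /M /noise_total W10 W20 /K; ring.
have aeD : {ae P, forall w, scheme W1 W2 N t (x0 - y0) (mu1 - mu2) sigma1 (- sigma2)
    j w @[j --> \oo] --> D w}.
  apply: (scheme_cvg s0 BW1 BW2 PN t0 (D := fun v w => X v w - Y v w)).
  apply: filterS sde => w [cX cY XY] v v0.
  by have [{1}-> {1}->] := XY _ v0; rewrite jumpXY//; ring.
have LM : L2 P M by exact: noise_total_L2.
have LK : L2 P (fun w => K + M w) by apply: L2D => //; exact: L2_cst.
have LS : L2 P S by exact: L2_ae aeS LK.
have LD : L2 P D by exact: (scheme_limit_L2 s0 BW1 BW2 PN ind t0 mDf aeD).
have ED := scheme_limit_mean s0 BW1 BW2 PN ind t0 mDf aeD.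
have ED2 := scheme_limit_sq s0 BW1 BW2 PN ind t0 mDf aeD.
have EDM := scheme_limit_noise s0 BW1 BW2 PN ind t0 mDf aeD sigma1 sigma2.
have EM := noise_total_mean BW1 BW2 ind t0 sigma1 sigma2.
have EM2 := noise_total_sq BW1 BW2 ind t0 sigma1 sigma2.
have LM1 := L2_L1 LM; have LD1 := L2_L1 LD; have LDM := L2M LD LM.
have [_ LM2] := LM; have LK1 : L1 P (cst K) by exact: L1_cst.
rewrite -/e -/mD in ED; rewrite -/e sqrrN in ED2; rewrite -/e -/M in EDM.
split=> //; first split=> //.
- have [mK _] := LK; rewrite -(L1_ae mK mS aeS (L2_L1 LK)).2.
  by rewrite (ExD LK1 LM1) EM addr0; exact: Ex_cst.
- have [mK2 LK2] := LK.
  have ae2 : {ae P, forall w, (K + M w) ^+ 2 = S w ^+ 2} by apply: filterS aeS => w ->.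
  rewrite -(L1_ae (measurable_funX 2 mK2) (measurable_funX 2 mS) ae2 LK2).2.
  have -> : (fun w => (K + M w) ^+ 2) = (fun w => (cst (K ^+ 2) w + 2 * K * M w) + M w ^+ 2).
    by apply/funext => w /=; ring.
  have LKM := L1Z (2 * K) LM1; have LK2' : L1 P (cst (K ^+ 2)) by exact: L1_cst.
  rewrite (ExD (L1D LK2' LKM) LM2) (ExD LK2' LKM) (ExZ _ LM1).
  by rewrite EM EM2 mulr0 addr0; congr (_ + _); exact: Ex_cst.
- have ae2 : {ae P, forall w, (K + M w) * D w = S w * D w} by apply: filterS aeS => w ->.
  have mK : measurable_fun setT (fun w => K + M w) by case: LK.
  have <- : Ex P (fun w => (K + M w) * D w) = Ex P (fun w => S w * D w).
    exact: (L1_ae (measurable_funM mK mDf) (measurable_funM mS mDf) ae2 (L2M LK LD)).2.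
  have -> : (fun w => (K + M w) * D w) = (fun w => K * D w + D w * M w).
    by apply/funext => w; ring.
  by rewrite (ExD (L1Z K LD1) LDM) (ExZ _ LD1) ED EDM; ring.
Qed.
End swapping_moments.

Unset Implicit Arguments.
Set Strict Implicit.

Theorem corollary5p7 (d : measure_display) (T : measurableType d)
    (R : realType) (P : probability T R)
    (mu1 mu2 sigma1 sigma2 s x0 y0 : R)
    (hsigma1 : 0 < sigma1) (hsigma2 : 0 < sigma2) (hs : 0 < s)
    (X Y : R -> {RV P >-> R})
    (hXY : brownian_swapping_process mu1 mu2 sigma1 sigma2 s x0 y0 X Y)
    (t : R) (ht : 0 < t) :
  let muD : \bar R := ('E_P[X t] - 'E_P[Y t])%E in
  let e : R := expR (- (2 * s * t)) in
  [/\ ('E_P[X t])%E = ((x0 + y0) / 2 + (x0 - y0) / 2 * e + (mu1 + mu2) / 2 * t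
                   + (mu1 - mu2) / (4 * s) * (1 - e))%:E,
      muD = ((x0 - y0) * e + (mu1 - mu2) / (2 * s) * (1 - e))%:E,
      ('V_P[X t])%E = (((sigma1 ^+ 2 + sigma2 ^+ 2) / 2
                     + (mu1 - mu2) ^+ 2 / (4 * s)) * t
                   + ((x0 - y0) ^+ 2 - fine muD ^+ 2) / 4
                   + ((mu1 - mu2) * (x0 - y0) / (4 * s)
                      + (sigma1 ^+ 2 - sigma2 ^+ 2) / (4 * s)
                      - (mu1 - mu2) ^+ 2 / (8 * s ^+ 2)) * (1 - e))%:E,
      ('V_P[X t] - 'V_P[Y t])%E =
        ((sigma1 ^+ 2 - sigma2 ^+ 2) / (2 * s) * (1 - e))%:E
    & covariance P (X t) (Y t) =
        ((fine muD ^+ 2 - (x0 - y0) ^+ 2) / 4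
         - (mu1 - mu2) ^+ 2 / (4 * s) * t
         - (mu1 - mu2) * (x0 - y0) / (4 * s) * (1 - e)
         + (mu1 - mu2) ^+ 2 / (8 * s ^+ 2) * (1 - e))%:E].
Proof.
move=> muD e.
have [[LS LD] [ES ED] ES2 ED2 ESD] := swapping_moments hs hXY ht.
rewrite -/e in ED ED2 ESD.
set S := (fun w => X t w + Y t w) in LS ES ES2 ESD.
set D := (fun w => X t w - Y t w) in LD ED ED2 ESD.
have [[_ LS2] [_ LD2]] := (LS, LD); have LSD := L2M LS LD.
(* X and Y are recovered from S and D, so every covariance of X and Y is a
   combination of the second moments of S and D. *)
have XE : X t = (fun w => 2^-1 * (S w + D w)) :> (T -> R).
  by apply/funext => w; rewrite /S /D; field.
have YE : Y t = (fun w => 2^-1 * (S w - D w)) :> (T -> R).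
  by apply/funext => w; rewrite /S /D; field.
have LX : L2 P (X t) by rewrite XE; apply: L2Z; exact: L2D.
have LY : L2 P (Y t) by rewrite YE; apply: L2Z; exact: L2B.
have LS1 := L2_L1 LS; have LD1 := L2_L1 LD.
have EX : Ex P (X t) = 2^-1 * (Ex P S + Ex P D).
  by rewrite XE (ExZ _ (L1D LS1 LD1)) (ExD LS1 LD1).
have EY : Ex P (Y t) = 2^-1 * (Ex P S - Ex P D).
  by rewrite YE (ExZ _ (L1B LS1 LD1)) (ExB LS1 LD1).
have Equad a b c (f : T -> R) :
    (forall w, f w = a * S w ^+ 2 + b * (S w * D w) + c * D w ^+ 2) ->
    Ex P f = a * Ex P (fun w => S w ^+ 2) + b * Ex P (fun w => S w * D w)
      + c * Ex P (fun w => D w ^+ 2).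
  move=> /funext ->; have [La Lb Lc] := And3 (L1Z a LS2) (L1Z b LSD) (L1Z c LD2).
  by rewrite (ExD (L1D La Lb) Lc) (ExD La Lb) (ExZ _ LS2) (ExZ _ LSD) (ExZ _ LD2).
have EXX := Equad (4^-1) (2^-1) (4^-1) (fun w => X t w * X t w).
have EYY := Equad (4^-1) (- 2^-1) (4^-1) (fun w => Y t w * Y t w).
have EXY := Equad (4^-1) 0 (- 4^-1) (fun w => X t w * Y t w).
have muDE : muD = ((x0 - y0) * e + (mu1 - mu2) / (2 * s) * (1 - e))%:E.
  rewrite /muD !ExE; [|exact: L2_L1..].
  by rewrite -EFinB EX EY ES ED; congr EFin; field; rewrite gt_eqF.
have s1 : s != 0 by rewrite gt_eqF.
rewrite muDE /variance !covariance_Ex//=.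
rewrite EXX; last by move=> w; rewrite /S /D; field.
rewrite EYY; last by move=> w; rewrite /S /D; field.
rewrite EXY; last by move=> w; rewrite /S /D; field.
rewrite -?EFinB EX EY ES ED ES2 ED2 ESD ExE; last exact: L2_L1.
split=> //; rewrite ?EX ?ES ?ED; congr EFin; field.
all: by rewrite ?s1.
Qed.
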